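(* For every Coxeter group $\mathbf{W}$ (with a fixed finite set $S$ of Coxeter generators), the Artin monoid $\mathbf{B}^+(\mathbf{W})$ admits the $(3,1)$-polygraph $\mathrm{Gar}_3(\mathbf{W})$ as a coherent presentation.
   Context: **Polygraphs and coherent presentations.** All $n$-categories are strict and globular; $f\star_i g$ is composition along $i$-cells in diagrammatic order. A $2$-polygraph consists of a set $\Sigma_0$ of $0$-cells, a set $\Sigma_1$ of generating $1$-cells with source and target in $\Sigma_0$ (generating the free category $\Sigma_1^*$), and a set $\Sigma_2$ of generating $2$-cells, each with source and target a pair of parallel $1$-cells of $\Sigma_1^*$. $\Sigma_2^\top$ denotes the free $(2,1)$-category it generates (all $2$-cells invertible for $\star_1$). The category presented is the quotient of $\Sigma_1^*$ by the congruence generated by $\Sigma_2$. A $(3,1)$-polygraph $\Sigma$ is a $2$-polygraph together with a set $\Sigma_3$ of generating $3$-cells, each with source and target a pair of parallel $2$-cells of $\Sigma_2^\top$; the category it presents is the one presented by its underlying $2$-polygraph, and the $(2,1)$-category it presents is $\overline{\Sigma}=\Sigma_2^\top/\Sigma_3$ (identify $s(\gamma)$ and $t(\gamma)$ for all $\gamma\in\Sigma_3$). $\Sigma$ is a coherent presentation of a category $\mathbf{C}$ if the category it presents is isomorphic to $\mathbf{C}$ and $\Sigma_3$ is a homotopy basis, i.e. any two parallel $2$-cells of $\Sigma_2^\top$ become equal in $\overline{\Sigma}$. A monoid is a category with one object. **Coxeter groups and Artin monoids.** $\mathbf{W}$ has presentation with generators $S$ and relations $(st)^{m_{st}}=1$,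 $m_{st}\in\mathbb{N}\cup\{\infty\}$ ($\infty$: no relation), $m_{st}=1$ iff $s=t$. Let $l$ be the length function with respect to $S$. The Artin monoid $\mathbf{B}^+(\mathbf{W})$ is generated by $S$ subject to the braid relations $sts\cdots=tst\cdots$ ($m_{st}$ letters on each side) for $s\neq t$ with $m_{st}<\infty$. **Garside's presentation.** $uv$ denotes the product in $\mathbf{W}$ and $u|v$ the product in the free monoid over $\mathbf{W}\setminus\{1\}$. $\mathrm{Gar}_2(\mathbf{W})$ is the $2$-polygraph with one $0$-cell, the elements of $\mathbf{W}\setminus\{1\}$ as $1$-cells, and one $2$-cell $\alpha_{u,v}:u|v\Rightarrow uv$ for all $u,v\in\mathbf{W}\setminus\{1\}$ with $l(uv)=l(u)+l(v)$. $\mathrm{Gar}_3(\mathbf{W})$ is $\mathrm{Gar}_2(\mathbf{W})$ extended with one $3$-cell $$A_{u,v,w}:\ (\alpha_{u,v}|w)\star_1\alpha_{uv,w}\ \Rrightarrow\ (u|\alpha_{v,w})\star_1\alpha_{u,vw}$$ for all $u,v,w\in\mathbf{W}\setminus\{1\}$ with $l(uv)=l(u)+l(v)$, $l(vw)=l(v)+l(w)$ and $l(uvw)=l(u)+l(v)+l(w)$. *)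

(* Defs.v *)
From mathcomp Require Import all_boot.
From mathcomp Require Import boolp.

Set Implicit Arguments.
Unset Strict Implicit.
Unset Printing Implicit Defensive.

Record category := Category {
  ob : Type;
  hom : ob -> ob -> Type;
  idc : forall x, hom x x;
  compc : forall x y z, hom x y -> hom y z -> hom x z;  (* diagrammatic order *)
  comp1c : forall x y (f : hom x y), compc (idc x) f = f;
  compc1 : forall x y (f : hom x y), compc f (idc y) = f;
  compcA : forall x y z t (f : hom x y) (g : hom y z) (h : hom z t),
    compc f (compc g h) = compc (compc f g) h
}.

Record functor (C D : category) := Functor {
  fob : ob C -> ob D;
  fhom : forall x y, hom x y -> hom (fob x) (fob y);
  fhom1 : forall x, fhom (idc x) = idc (fob x);
  fhomM : forall x y z (f : hom x y) (g : hom y z),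
    fhom (compc f g) = compc (fhom f) (fhom g)
}.

Definition functor_id (C : category) : functor C C :=
  @Functor C C (fun x => x) (fun _ _ f => f)
    (fun _ => erefl) (fun _ _ _ _ _ => erefl).

Definition functor_comp (C D E : category) (F : functor C D) (G : functor D E) :
  functor C E.
Proof.
exists (fun x => fob G (fob F x)) (fun x y f => fhom G (fhom F f)).
- by move=> x; rewrite !fhom1.
- by move=> x y z f g; rewrite !fhomM.
Defined.

Definition isomorphic (C D : category) : Prop :=
  exists (F : functor C D) (G : functor D C),
    functor_comp F G = functor_id C /\ functor_comp G F = functor_id D.

Record quiver := Quiver {
  cell0 : Type;
  cell1 : Type;
  src0 : cell1 -> cell0;
  tgt0 : cell1 -> cell0
}.

(* The 1-cells of the free category on [Q]. *)
Inductive gpath (Q : quiver) : cell0 Q -> cell0 Q -> Type :=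
| pnil x : gpath x x
| pcons (a : cell1 Q) z : gpath (tgt0 a) z -> gpath (src0 a) z.

Fixpoint pcat (Q : quiver) (x y z : cell0 Q) (f : gpath x y) :
    gpath y z -> gpath x z :=
  match f in gpath x y return gpath y z -> gpath x z with
  | pnil _ => fun g => g
  | pcons a _ f' => fun g => pcons (pcat f' g)
  end.

Lemma pcatp0 (Q : quiver) (x y : cell0 Q) (f : gpath x y) :
  pcat f (pnil y) = f.
Proof. by elim: f => //= a z f ->. Qed.

Lemma pcatA (Q : quiver) (x y z t : cell0 Q)
    (f : gpath x y) (g : gpath y z) (h : gpath z t) :
  pcat f (pcat g h) = pcat (pcat f g) h.
Proof. by elim: f g => //= a z' f IHf g; rewrite IHf. Qed.

Record polygraph2 := Polygraph2 {
  pquiver :> quiver;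
  cell2 : Type;
  src20 : cell2 -> cell0 pquiver;
  tgt20 : cell2 -> cell0 pquiver;
  src21 : forall a, gpath (src20 a) (tgt20 a);
  tgt21 : forall a, gpath (src20 a) (tgt20 a)
}.

(* The congruence on the free category generated by the 2-cells. *)
Inductive pres_eq (P : polygraph2) :
    forall x y : cell0 P, gpath x y -> gpath x y -> Prop :=
| pres_eq_cell (a : cell2 P) : pres_eq (src21 a) (tgt21 a)
| pres_eq_refl x y (f : gpath x y) : pres_eq f f
| pres_eq_sym x y (f g : gpath x y) : pres_eq f g -> pres_eq g f
| pres_eq_trans x y (f g h : gpath x y) : pres_eq f g -> pres_eq g h -> pres_eq f h
| pres_eq_cat x y z (f f' : gpath x y) (g g' : gpath y z) :
    pres_eq f f' -> pres_eq g g' -> pres_eq (pcat f g) (pcat f' g').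

Section Quotient.
Variables (T : Type) (R : T -> T -> Prop).

(* The set of classes [R x]; below [R] is always an equivalence relation. *)
Definition quot : Type := {X : T -> Prop | exists x, X = R x}.

Definition quot_class (x : T) : quot := exist _ (R x) (ex_intro _ x erefl).

Definition quot_repr (X : quot) : T := projT1 (cid (proj2_sig X)).

Lemma quot_reprK X : quot_class (quot_repr X) = X.
Proof.
rewrite /quot_repr; case: cid; case: X => Y eY x /= e.
by apply: eq_exist; rewrite e.
Qed.

Hypotheses (Rr : forall x, R x x) (Rs : forall x y, R x y -> R y x)
  (Rt : forall x y z, R x y -> R y z -> R x z).

Lemma quot_classP x y : quot_class x = quot_class y <-> R x y.
Proof.
split=> [/(congr1 (@proj1_sig _ _)) /= Exy|Rxy]; first by rewrite Exy.
apply: eq_exist; apply/funext => z.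
by apply/propext; split; apply: Rt => //; apply: Rs.
Qed.

End Quotient.

Section PresentedCategory.
Variable P : polygraph2.

Definition pres_hom (x y : cell0 P) : Type := quot (@pres_eq P x y).

Definition pres_class (x y : cell0 P) (f : gpath x y) : pres_hom x y :=
  quot_class (@pres_eq P x y) f.

Definition pres_comp (x y z : cell0 P) (X : pres_hom x y) (Y : pres_hom y z) :
  pres_hom x z := pres_class (pcat (quot_repr X) (quot_repr Y)).

Lemma pres_classP (x y : cell0 P) (f g : gpath x y) :
  pres_class f = pres_class g <-> pres_eq f g.
Proof. apply: quot_classP; [exact: pres_eq_refl|exact: pres_eq_sym|exact: pres_eq_trans]. Qed.

Lemma pres_reprK (x y : cell0 P) (X : pres_hom x y) : pres_class (quot_repr X) = X.
Proof. exact: quot_reprK. Qed.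

Lemma pres_compE (x y z : cell0 P) (f : gpath x y) (g : gpath y z) :
  pres_comp (pres_class f) (pres_class g) = pres_class (pcat f g).
Proof. by apply/pres_classP; apply: pres_eq_cat; apply/pres_classP/pres_reprK. Qed.

Lemma pres_comp1c (x y : cell0 P) (X : pres_hom x y) :
  pres_comp (pres_class (pnil x)) X = X.
Proof. by rewrite -[X]pres_reprK pres_compE. Qed.

Lemma pres_compc1 (x y : cell0 P) (X : pres_hom x y) :
  pres_comp X (pres_class (pnil y)) = X.
Proof. by rewrite -[X]pres_reprK pres_compE pcatp0. Qed.

Lemma pres_compcA (x y z t : cell0 P)
    (X : pres_hom x y) (Y : pres_hom y z) (Z : pres_hom z t) :
  pres_comp X (pres_comp Y Z) = pres_comp (pres_comp X Y) Z.
Proof.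
by rewrite -[X]pres_reprK -[Y]pres_reprK -[Z]pres_reprK !pres_compE pcatA.
Qed.

Definition presented_category : category :=
  Category pres_comp1c pres_compc1 pres_compcA.

End PresentedCategory.

(* Formal composites of generating 2-cells and of their inverses: [tcomp0] and
   [tcomp1] are composition along 0-cells and 1-cells.  The 2-cells of the free
   (2,1)-category are these terms modulo the (2,1)-category axioms. *)
Inductive term2 (P : polygraph2) :
    forall x y : cell0 P, gpath x y -> gpath x y -> Type :=
| tgen (a : cell2 P) : term2 (src21 a) (tgt21 a)
| tid x y (f : gpath x y) : term2 f f
| tinv x y (f g : gpath x y) : term2 f g -> term2 g f
| tcomp1 x y (f g h : gpath x y) : term2 f g -> term2 g h -> term2 f h
| tcomp0 x y z (f f' : gpath x y) (g g' : gpath y z) :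
    term2 f f' -> term2 g g' -> term2 (pcat f g) (pcat f' g').

Definition tcast (P : polygraph2) (x y : cell0 P) (f f' g g' : gpath x y)
    (ef : f = f') (eg : g = g') (a : term2 f g) : term2 f' g' :=
  match ef in _ = f1, eg in _ = g1 return term2 f1 g1 with
  | erefl, erefl => a
  end.

(* The boundary 2-cells of a 3-cell are given by representing terms. *)
Record polygraph31 := Polygraph31 {
  ppolygraph2 :> polygraph2;
  cell3 : Type;
  src30 : cell3 -> cell0 ppolygraph2;
  tgt30 : cell3 -> cell0 ppolygraph2;
  src31 : forall A, gpath (src30 A) (tgt30 A);
  tgt31 : forall A, gpath (src30 A) (tgt30 A);
  src32 : forall A, term2 (src31 A) (tgt31 A);
  tgt32 : forall A, term2 (src31 A) (tgt31 A)
}.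

(* Equality of 2-cells in the (2,1)-category presented by [P], i.e. the free
   (2,1)-category with the boundaries of each 3-cell identified.  The casts
   account for associativity and right unitality of the concatenation of paths,
   which are not definitional. *)
Inductive eq21 (P : polygraph31) :
    forall (x y : cell0 P) (f g : gpath x y), term2 f g -> term2 f g -> Prop :=
| eq21_cell (A : cell3 P) : eq21 (src32 A) (tgt32 A)
| eq21_refl x y (f g : gpath x y) (a : term2 f g) : eq21 a a
| eq21_sym x y (f g : gpath x y) (a b : term2 f g) : eq21 a b -> eq21 b a
| eq21_trans x y (f g : gpath x y) (a b c : term2 f g) :
    eq21 a b -> eq21 b c -> eq21 a c
| eq21_inv x y (f g : gpath x y) (a b : term2 f g) :
    eq21 a b -> eq21 (tinv a) (tinv b)
| eq21_comp1 x y (f g h : gpath x y) (a a' : term2 f g) (b b' : term2 g h) :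
    eq21 a a' -> eq21 b b' -> eq21 (tcomp1 a b) (tcomp1 a' b')
| eq21_comp0 x y z (f f' : gpath x y) (g g' : gpath y z)
      (a a' : term2 f f') (b b' : term2 g g') :
    eq21 a a' -> eq21 b b' -> eq21 (tcomp0 a b) (tcomp0 a' b')
| eq21_comp1A x y (f g h k : gpath x y)
      (a : term2 f g) (b : term2 g h) (c : term2 h k) :
    eq21 (tcomp1 (tcomp1 a b) c) (tcomp1 a (tcomp1 b c))
| eq21_id1l x y (f g : gpath x y) (a : term2 f g) : eq21 (tcomp1 (tid f) a) a
| eq21_id1r x y (f g : gpath x y) (a : term2 f g) : eq21 (tcomp1 a (tid g)) a
| eq21_invr x y (f g : gpath x y) (a : term2 f g) :
    eq21 (tcomp1 a (tinv a)) (tid f)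
| eq21_invl x y (f g : gpath x y) (a : term2 f g) :
    eq21 (tcomp1 (tinv a) a) (tid g)
| eq21_exchange x y z (f g h : gpath x y) (f' g' h' : gpath y z)
      (a : term2 f g) (b : term2 g h) (a' : term2 f' g') (b' : term2 g' h') :
    eq21 (tcomp0 (tcomp1 a b) (tcomp1 a' b'))
         (tcomp1 (tcomp0 a a') (tcomp0 b b'))
| eq21_id0 x y z (f : gpath x y) (g : gpath y z) :
    eq21 (tcomp0 (tid f) (tid g)) (tid (pcat f g))
| eq21_comp0A x y z t (f f' : gpath x y) (g g' : gpath y z) (h h' : gpath z t)
      (a : term2 f f') (b : term2 g g') (c : term2 h h') :
    eq21 (tcast (pcatA f g h) (pcatA f' g' h') (tcomp0 a (tcomp0 b c)))
         (tcomp0 (tcomp0 a b) c)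
| eq21_id0l x y (f g : gpath x y) (a : term2 f g) :
    eq21 (tcomp0 (tid (pnil x)) a) a
| eq21_id0r x y (f g : gpath x y) (a : term2 f g) :
    eq21 (tcast (pcatp0 f) (pcatp0 g) (tcomp0 a (tid (pnil y)))) a.

Definition homotopy_basis (P : polygraph31) : Prop :=
  forall (x y : cell0 P) (f g : gpath x y) (a b : term2 f g), eq21 a b.

Definition coherent_presentation (P : polygraph31) (C : category) : Prop :=
  isomorphic (presented_category P) C /\ homotopy_basis P.

Section GroupPresentation.
Variables (S : Type) (rel : seq (S * bool) -> Prop).

(* A letter [(s, e)] stands for [s] if [e = false] and for the formal inverse of
   [s] if [e = true]. *)
Inductive gpres_eq : seq (S * bool) -> seq (S * bool) -> Prop :=
| gpres_cancel s e : gpres_eq [:: (s, e); (s, ~~ e)] [::]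
| gpres_rel r : rel r -> gpres_eq r [::]
| gpres_refl w : gpres_eq w w
| gpres_sym w w' : gpres_eq w w' -> gpres_eq w' w
| gpres_trans w w' w'' : gpres_eq w w' -> gpres_eq w' w'' -> gpres_eq w w''
| gpres_cat v v' w w' :
    gpres_eq v v' -> gpres_eq w w' -> gpres_eq (v ++ w) (v' ++ w').

Variables (G : groupType) (gen : S -> G).

Definition gpres_val (w : seq (S * bool)) : G :=
  (\prod_(p <- w) (if p.2 then (gen p.1)^-1 else gen p.1))%g.

Definition group_presentation : Prop :=
  (forall u : G, exists w, gpres_val w = u) /\
  (forall w w', gpres_val w = gpres_val w' <-> gpres_eq w w').

End GroupPresentation.

(* The relators $(st)^{m_{st}}$; [None] stands for infinity. *)
Definition coxeter_rel (S : Type) (m : S -> S -> option nat)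
    (r : seq (S * bool)) : Prop :=
  exists s t n,
    m s t = Some n /\ r = flatten (nseq n [:: (s, false); (t, false)]).

Record coxeter_group := CoxeterGroup {
  cox_sort :> groupType;
  cox_gens : finType;
  cox_gen : cox_gens -> cox_sort;
  cox_mx : cox_gens -> cox_gens -> option nat;
  cox_mxC : forall s t, cox_mx s t = cox_mx t s;
  cox_mx1 : forall s t, cox_mx s t = Some 1%N <-> s = t;
  cox_pres : group_presentation (coxeter_rel cox_mx) cox_gen
}.

Section Length.
Variable W : coxeter_group.
Local Open Scope group_scope.

Definition cox_val (w : seq (cox_gens W)) : W := \prod_(s <- w) cox_gen s.

Lemma cox_gen_inv (s : cox_gens W) : (cox_gen s)^-1 = cox_gen s.
Proof.
have [_ /(_ [:: (s, false); (s, false)] [::])[_ H]] := cox_pres W.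
have /H : gpres_eq (coxeter_rel (@cox_mx W)) [:: (s, false); (s, false)] [::].
  by apply: gpres_rel; exists s, s, 1%N; split=> //; apply/cox_mx1.
rewrite /gpres_val !big_cons !big_nil mulg1 /= => ss.
by apply: (@mulgI _ (cox_gen s)); rewrite mulgV.
Qed.

Lemma cox_val_ex (u : W) :
  exists n, [exists w : n.-tuple (cox_gens W), cox_val w == u].
Proof.
have [/(_ u)[w <-] _] := cox_pres W.
exists (size (map fst w)).
apply/existsP; exists (in_tuple (map fst w)); apply/eqP.
rewrite /cox_val /gpres_val big_map; apply: eq_bigr => -[s e] _ /=.
by case: e; rewrite ?cox_gen_inv.
Qed.

(* As the generators are involutions, words without inverse letters suffice. *)
Definition cox_length (u : W) : nat := ex_minn (cox_val_ex u).

Lemma length_eq0 (u : W) : (cox_length u == 0)%N = (u == 1).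
Proof.
rewrite /cox_length; case: ex_minnP => n /existsP[w /eqP <-] nmin.
apply/eqP/eqP => [n0|w1].
  by subst n; rewrite (tuple0 w) /cox_val big_nil.
apply/eqP; rewrite -leqn0; apply: nmin; apply/existsP; exists [tuple].
by rewrite w1 /cox_val big_nil.
Qed.

End Length.

Definition bouquet (A : Type) : quiver :=
  @Quiver unit A (fun _ => tt) (fun _ => tt).

Fixpoint word_path (A : Type) (w : seq A) : @gpath (bouquet A) tt tt :=
  if w is a :: w' then @pcons (bouquet A) a tt (word_path w')
  else @pnil (bouquet A) tt.

Section Garside.
Variable W : coxeter_group.
Local Open Scope group_scope.

Record braid_rel := BraidRel {
  br_s : cox_gens W;
  br_t : cox_gens W;
  br_n : nat;
  br_neq : br_s <> br_t;
  br_mx : cox_mx br_s br_t = Some br_n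
}.

(* $s t s \cdots$, with $n$ letters *)
Definition alternating (s t : cox_gens W) (n : nat) : seq (cox_gens W) :=
  mkseq (fun i => if odd i then t else s) n.

Definition artin_polygraph : polygraph2 :=
  @Polygraph2 (bouquet (cox_gens W)) braid_rel (fun _ => tt) (fun _ => tt)
    (fun r => word_path (alternating (br_s r) (br_t r) (br_n r)))
    (fun r => word_path (alternating (br_t r) (br_s r) (br_n r))).

(* The monoid is taken as a category with one object. *)
Definition artin_monoid : category := presented_category artin_polygraph.

Definition gar1 : Type := {u : W | u != 1}.

Record gar_cell2 := GarCell2 {
  g2u : gar1;
  g2v : gar1;
  g2_len : cox_length (sval g2u * sval g2v) =
    (cox_length (sval g2u) + cox_length (sval g2v))%N
}.

Lemma gar_mul_subproof (a : gar_cell2) : sval (g2u a) * sval (g2v a) != 1.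
Proof.
rewrite -length_eq0 g2_len addn_eq0 negb_and !length_eq0.
by rewrite (proj2_sig (g2u a)).
Qed.

Definition gar_mul (a : gar_cell2) : gar1 :=
  exist (fun u : W => u != 1) _ (gar_mul_subproof a).

Definition Gar2 : polygraph2 :=
  @Polygraph2 (bouquet gar1) gar_cell2 (fun _ => tt) (fun _ => tt)
    (fun a => word_path [:: g2u a; g2v a])
    (fun a => word_path [:: gar_mul a]).

Definition alpha (a : gar_cell2) :
    @term2 Gar2 tt tt (word_path [:: g2u a; g2v a]) (word_path [:: gar_mul a]) :=
  @tgen Gar2 a.

Record gar_cell3 := GarCell3 {
  g3u : gar1;
  g3v : gar1;
  g3w : gar1;
  g3_uv : cox_length (sval g3u * sval g3v) =
    (cox_length (sval g3u) + cox_length (sval g3v))%N;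
  g3_vw : cox_length (sval g3v * sval g3w) =
    (cox_length (sval g3v) + cox_length (sval g3w))%N;
  g3_uvw : cox_length (sval g3u * sval g3v * sval g3w) =
    (cox_length (sval g3u) + cox_length (sval g3v) + cox_length (sval g3w))%N
}.

Section GarCell3Faces.
Variable A : gar_cell3.

Definition face_u_v : gar_cell2 := GarCell2 (g3_uv A).
Definition face_v_w : gar_cell2 := GarCell2 (g3_vw A).

Lemma face_uv_w_subproof :
  cox_length (sval (gar_mul face_u_v) * sval (g3w A)) =
    (cox_length (sval (gar_mul face_u_v)) + cox_length (sval (g3w A)))%N.
Proof. by rewrite /= g3_uvw g3_uv. Qed.

Lemma face_u_vw_subproof :
  cox_length (sval (g3u A) * sval (gar_mul face_v_w)) =
    (cox_length (sval (g3u A)) + cox_length (sval (gar_mul face_v_w)))%N.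
Proof. by rewrite /= mulgA g3_uvw g3_vw addnA. Qed.

Definition face_uv_w : gar_cell2 := GarCell2 face_uv_w_subproof.
Definition face_u_vw : gar_cell2 := GarCell2 face_u_vw_subproof.

Lemma gar_mulA : gar_mul face_u_vw = gar_mul face_uv_w.
Proof. by apply: val_inj; rewrite /= mulgA. Qed.

Definition gar_src3 : @term2 Gar2 tt tt
    (word_path [:: g3u A; g3v A; g3w A]) (word_path [:: gar_mul face_uv_w]) :=
  tcomp1 (tcomp0 (alpha face_u_v) (@tid Gar2 tt tt (word_path [:: g3w A])))
         (alpha face_uv_w).

Definition gar_tgt3 : @term2 Gar2 tt tt
    (word_path [:: g3u A; g3v A; g3w A]) (word_path [:: gar_mul face_uv_w]) :=
  @tcast Gar2 tt tt _ _ _ _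
    erefl (congr1 (fun x => word_path [:: x]) gar_mulA)
    (tcomp1 (tcomp0 (@tid Gar2 tt tt (word_path [:: g3u A])) (alpha face_v_w))
            (alpha face_u_vw)).

End GarCell3Faces.

Definition Gar3 : polygraph31 :=
  @Polygraph31 Gar2 gar_cell3 (fun _ => tt) (fun _ => tt)
    (fun A => word_path [:: g3u A; g3v A; g3w A])
    (fun A => word_path [:: gar_mul (face_uv_w A)])
    gar_src3 gar_tgt3.

End Garside.

(* Main.v *)
(** A word over W \ {1} is multiplied on the left by an element a by splitting its first
    letter x as y z, where y is the greatest prefix of x (in the weak order) such that
    l(ay) = l(a) + l(y): the new first letter is ay, and z is multiplied into the rest.
    This is compatible with the products of Gar_2(W), so it computes a normal form gar_nf
    of the elements of the monoid; y exists by Newman's lemma, as the prefixes in question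
    are closed under joins of rank 2.

    For coherence, reduce a word x|w to its normal form m|r with m = xy by first taking w
    to y|r (uniquely, by induction on the length) and then applying alpha_{x,y}.  These
    standard reductions absorb every generating 2-cell: inside the tail by induction, and
    at the head alpha_{u,v} by the 3-cell A_{u,v,y}.  Hence every 2-cell f => g equals the
    standard reduction of f followed by the inverse of that of g.

    For the presented monoid, a letter u of W is sent to a reduced word of u, which is
    well defined by Matsumoto's theorem.  That theorem requires the order of st to be
    exactly m_st, which is read off a reflection representation. *)
From mathcomp Require Import all_boot all_order all_algebra all_field.
From mathcomp Require Import boolp zify ring.
Require Import Defs.

Set Implicit Arguments.
Unset Strict Implicit.
Unset Printing Implicit Defensive.

(** * Paths of a bouquet *)

Fixpoint path_word (Q : quiver) (x y : cell0 Q) (f : gpath x y) : seq (cell1 Q) :=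
  match f with
  | pnil _ => [::]
  | pcons a _ f' => a :: path_word f'
  end.

Lemma path_word_cat (Q : quiver) (x y z : cell0 Q) (f : gpath x y) (g : gpath y z) :
  path_word (pcat f g) = path_word f ++ path_word g.
Proof. by elim: f g => //= a z' f IHf g; rewrite IHf. Qed.

Lemma word_pathK A (w : seq A) : path_word (word_path w) = w.
Proof. by elim: w => //= a w ->. Qed.

Lemma path_wordK A (f : @gpath (bouquet A) tt tt) : word_path (path_word f) = f.
Proof.
suff H x y (g : @gpath (bouquet A) x y) :
    match x, y return @gpath (bouquet A) x y -> Prop with
    | tt, tt => fun g => word_path (path_word g) = g
    end g by exact: (H tt tt).
elim: g => [[] //|a [] g /= IHg].
by rewrite IHg.
Qed.

Lemma word_path_cat A (w w' : seq A) :
  word_path (w ++ w') = pcat (word_path w) (word_path w').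
Proof. by elim: w => //= a w ->. Qed.

(** * Inversions in Coxeter groups *)

Section CoxeterActions.
Variable W : coxeter_group.
Local Notation S := (cox_gens W).
Local Notation gen := (@cox_gen W).
Local Open Scope group_scope.

Lemma cox_val_nil : cox_val [::] = 1 :> W.
Proof. by rewrite /cox_val big_nil. Qed.

Lemma cox_val_cons s (w : seq S) : cox_val (s :: w) = gen s * cox_val w.
Proof. by rewrite /cox_val big_cons. Qed.

Lemma cox_val_cat (w1 w2 : seq S) : cox_val (w1 ++ w2) = cox_val w1 * cox_val w2.
Proof. by rewrite /cox_val big_cat. Qed.

Lemma cox_gen_sqr (s : S) : gen s * gen s = 1.
Proof. by rewrite -{1}cox_gen_inv mulVg. Qed.

Lemma cox_genK (s : S) (u : W) : gen s * (gen s * u) = u.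
Proof. by rewrite mulgA cox_gen_sqr mul1g. Qed.

Lemma cox_val_rev (w : seq S) : cox_val (rev w) = (cox_val w)^-1.
Proof.
elim: w => [|s w IHw]; first by rewrite !cox_val_nil invg1.
by rewrite rev_cons -cats1 cox_val_cat IHw !cox_val_cons cox_val_nil mulg1
  invgM cox_gen_inv.
Qed.

Lemma cox_gen_expg (s t : S) n : cox_mx s t = Some n -> (gen s * gen t) ^+ n = 1.
Proof.
move=> st; have [_ /(_ (flatten (nseq n [:: (s, false); (t, false)])) [::])[_ H]] :=
  cox_pres W.
have /H : gpres_eq (coxeter_rel (@cox_mx W))
    (flatten (nseq n [:: (s, false); (t, false)])) [::].
  by apply: gpres_rel; exists s, t, n.
rewrite /gpres_val big_nil => <-.
elim: (n) => [|k IHk]; first by rewrite big_nil.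
by rewrite expgS IHk /= !big_cons /= mulgA.
Qed.

(** The presentation of W turns maps satisfying the Coxeter relations into an action. The relation
    for s = t makes each map an involution, so a letter and its formal inverse can act alike. *)
Lemma cox_action (X : Type) (act : S -> X -> X) :
  (forall s t n x, cox_mx s t = Some n -> iter n (act s \o act t) x = x) ->
  forall (w w' : seq S), cox_val w = cox_val w' ->
  forall x, foldr act x w = foldr act x w'.
Proof.
move=> actM; have actK s x : act s (act s x) = x.
  by apply: (actM s s 1%N); apply/cox_mx1.
have act_eq v v' : gpres_eq (coxeter_rel (@cox_mx W)) v v' ->
    forall x, foldr (fun p => act p.1) x v = foldr (fun p => act p.1) x v'.
  elim=> {v v'} [s e x|r [s [t [n [st ->]]]] x|//|v v' _ IH x|v v' v'' _ IH _ IH' x|].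
  - by rewrite /= actK.
  - rewrite /= -[RHS](actM _ _ _ _ st).
    by elim: (n) => //= k ->.
  - by rewrite IH.
  - by rewrite IH.
  - by move=> v v' w w' _ IH _ IH' x; rewrite !foldr_cat IH IH'.
move=> w w' ww' x.
have vE (v : seq S) : gpres_val gen [seq (s, false) | s <- v] = cox_val v.
  by rewrite /gpres_val big_map.
have [_ /(_ [seq (s, false) | s <- w] [seq (s, false) | s <- w'])] := cox_pres W.
by rewrite !vE => -[/(_ ww') /act_eq /(_ x)]; rewrite !foldr_map.
Qed.

(* The reflections $s_1\cdots s_{i-1} s_i s_{i-1}\cdots s_1$ of a word. *)
Fixpoint refl_seq (w : seq S) : seq W :=
  if w is s :: w' then gen s :: [seq gen s * r * gen s | r <- refl_seq w'] else [::].

Lemma size_refl_seq w : size (refl_seq w) = size w.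
Proof. by elim: w => //= s w IHw; rewrite size_map IHw. Qed.

Lemma conj_gen_inj (s : S) : injective (fun r : W => gen s * r * gen s).
Proof. by move=> r r' /= /mulIg /mulgI. Qed.

Lemma conj_genK (s : S) (r : W) : gen s * (gen s * r * gen s) * gen s = r.
Proof. by rewrite -!mulgA cox_gen_sqr mulg1 cox_genK. Qed.

Lemma alternatingS (s t : S) n : alternating s t n.+1 = s :: alternating t s n.
Proof.
rewrite /alternating /mkseq /= -[1%N]addn0 iotaDl -map_comp; congr cons.
by apply: eq_map => i /=; case: (odd i).
Qed.

Lemma size_alternating (s t : S) n : size (alternating s t n) = n.
Proof. by rewrite size_mkseq. Qed.

Lemma alternatingD (s t : S) m n :
  exists w, alternating s t (m + n) = alternating s t m ++ w.
Proof.
elim: m s t => [|m IHm] s t; first by eexists; rewrite add0n.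
by have [w e] := IHm t s; exists w; rewrite addSn !alternatingS e.
Qed.

Lemma refl_seq_alternating (s t : S) n :
  refl_seq (alternating s t n) = mkseq (fun i => (gen s * gen t) ^+ i * gen s) n.
Proof.
elim: n s t => // n IHn s t; rewrite alternatingS /= IHn.
rewrite /mkseq /= expg0 mul1g -[1%N]addn0 iotaDl -!map_comp; congr cons.
apply: eq_map => i /=; rewrite add1n.
elim: i => [|i IHi]; first by rewrite expg0 expg1 mul1g.
rewrite expgS [in RHS]expgS -!mulgA; congr (_ * (_ * _)).
by rewrite -IHi !mulgA.
Qed.

Lemma cox_val_alternating_double (s t : S) n :
  cox_val (alternating s t n.*2) = (gen s * gen t) ^+ n.
Proof.
elim: n => [|n IHn]; first by rewrite cox_val_nil.
by rewrite doubleS !alternatingS !cox_val_cons IHn expgS mulgA.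
Qed.

Lemma iter_comp_foldr X (act : S -> X -> X) s t n x :
  iter n (act s \o act t) x = foldr act x (alternating s t n.*2).
Proof. by elim: n => [|n IHn] //; rewrite doubleS !alternatingS /= IHn. Qed.

(** An affine action over GF(2): functions on W are conjugated and shifted by an indicator. It is a
    variant of the classical action on signed reflections. *)
Definition parity_act (s : S) (h : W -> bool) (r : W) : bool :=
  (gen s == r) (+) h (gen s * r * gen s).

Lemma foldr_parity_act h w r :
  foldr parity_act h w r =
    odd (count_mem r (refl_seq w)) (+) h ((cox_val w)^-1 * r * cox_val w).
Proof.
elim: w r => [|s w IHw] r /=; first by rewrite cox_val_nil invg1 mul1g mulg1.
rewrite /parity_act IHw addbA cox_val_cons invgM cox_gen_inv !mulgA; congr (_ (+) _).
rewrite oddD oddb; congr (_ (+) odd _).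
rewrite count_map; apply: eq_count => r' /=.
by rewrite -(inj_eq (@conj_gen_inj s)) conj_genK.
Qed.

(** The word $(st)^n$ has the reflections $(st)^i s$ for i < 2n. Since $(st)^n = 1$, the second half
    repeats the first, so all multiplicities are even. *)
Lemma parity_act_relation s t n h :
  cox_mx s t = Some n -> iter n (parity_act s \o parity_act t) h = h.
Proof.
move=> st; apply: funext => r; rewrite iter_comp_foldr foldr_parity_act.
have st1 := cox_gen_expg st.
rewrite cox_val_alternating_double st1 invg1 mul1g mulg1 refl_seq_alternating.
rewrite /mkseq -addnn iotaD map_cat count_cat add0n.
have -> : iota n n = map (addn n) (iota 0 n) by rewrite -iotaDl addn0.
rewrite -map_comp.
set c := count _ _; set d := count _ _; suff -> : d = c by rewrite addnn odd_double.
congr count; apply: eq_map => i /=.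
by rewrite expgnDr st1 mul1g.
Qed.

(** * Length and inversions *)

Lemma cox_word_ex (u : W) :
  exists w, cox_val w = u /\ size w = cox_length u.
Proof.
rewrite /cox_length; case: ex_minnP => n /existsP[w /eqP wu] _.
by exists w; rewrite size_tuple.
Qed.

Definition cox_word (u : W) : seq S := projT1 (cid (cox_word_ex u)).

Lemma cox_wordK u : cox_val (cox_word u) = u.
Proof. by rewrite /cox_word; case: cid => w []. Qed.

Lemma size_cox_word u : size (cox_word u) = cox_length u.
Proof. by rewrite /cox_word; case: cid => w []. Qed.

Lemma cox_length_val w : cox_length (cox_val w : W) <= size w.
Proof.
rewrite /cox_length; case: ex_minnP => n _; apply.
by apply/existsP; exists (in_tuple w).
Qed.

(* Over GF(2), the multiplicity of [r] among the reflections of a word depends only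
   on the value of the word; it is nonzero iff [r] is a left inversion. *)
Definition inversion (u r : W) : bool := odd (count_mem r (refl_seq (cox_word u))).

Lemma inversion_val w r : inversion (cox_val w) r = odd (count_mem r (refl_seq w)).
Proof.
have /(_ (fun=> false)) := cox_action parity_act_relation (cox_wordK (cox_val w)).
by move=> /(congr1 (fun f => f r)); rewrite !foldr_parity_act !addbF.
Qed.

Lemma inversion1 r : inversion 1 r = false.
Proof. by rewrite -cox_val_nil inversion_val. Qed.

(** Cocycle identity: as sets modulo 2, the inversions satisfy $N(uv) = N(u) + u N(v) u^{-1}$. *)
Lemma inversionM u v r : inversion (u * v) r = inversion u r (+) inversion v (u^-1 * r * u).
Proof.
rewrite -(cox_wordK u) -(cox_wordK v) -cox_val_cat !inversion_val.
have := foldr_parity_act (fun=> false) (cox_word u ++ cox_word v) r.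
by rewrite addbF => <-; rewrite foldr_cat !foldr_parity_act addbF.
Qed.

Lemma inversion_gen s r : inversion (gen s) r = (gen s == r).
Proof.
by have := inversion_val [:: s] r; rewrite cox_val_cons cox_val_nil mulg1 /= addn0 oddb.
Qed.

Lemma inversionV u r : inversion u^-1 r = inversion u (u * r * u^-1).
Proof.
have := inversion1 r; rewrite -(mulVg u) inversionM invgK => /eqP.
by rewrite addbC; case: inversion; case: inversion.
Qed.

Lemma cox_lengthM (u v : W) : cox_length (u * v) <= cox_length u + cox_length v.
Proof.
rewrite -{1}(cox_wordK u) -{1}(cox_wordK v) -cox_val_cat.
by rewrite (leq_trans (cox_length_val _)) // size_cat !size_cox_word.
Qed.

Lemma cox_lengthV (u : W) : cox_length u^-1 = cox_length u.
Proof.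
have le (v : W) : cox_length v^-1 <= cox_length v.
  by rewrite -{1}(cox_wordK v) -cox_val_rev -(size_cox_word v) -size_rev cox_length_val.
by apply/eqP; rewrite eqn_leq le -{1}(invgK u) le.
Qed.

Lemma cox_length1 : cox_length (1 : W) = 0.
Proof. by apply/eqP; rewrite length_eq0. Qed.

(** Exchange property: multiplying on the left by the i-th reflection $s_1\cdots s_i\cdots s_1$
    cancels the letter $s_i$. *)
Lemma refl_seq_delete w r : r \in refl_seq w ->
  exists w', [/\ subseq w' w, size w = (size w').+1 & cox_val w' = r * cox_val w].
Proof.
elim: w r => //= s w IHw r; rewrite inE => /orP[/eqP ->|/mapP[r' /IHw]].
  by exists w; rewrite cox_val_cons cox_genK; split=> //; apply: subseq_cons.
case=> w' [sw' sz e] ->; exists (s :: w'); rewrite /= eqxx sz; split=> //.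
by rewrite !cox_val_cons e -!mulgA cox_genK.
Qed.

Lemma inversion_mem w r : inversion (cox_val w) r -> r \in refl_seq w.
Proof. by rewrite inversion_val -has_pred1 has_count; case: count. Qed.

Lemma inversion_length u r : inversion u r -> cox_length (r * u) < cox_length u.
Proof.
rewrite -{1}(cox_wordK u) => /inversion_mem /refl_seq_delete[w [_ sz e]].
rewrite -(size_cox_word u) sz ltnS -{1}(cox_wordK u) -e; exact: cox_length_val.
Qed.

Lemma inversion_genM s u : inversion (gen s * u) (gen s) = ~~ inversion u (gen s).
Proof. by rewrite inversionM inversion_gen eqxx /= mulVg mul1g. Qed.

Lemma cox_length_genM (s : S) (u : W) :
  cox_length (gen s * u) =
    if inversion u (gen s) then (cox_length u).-1 else (cox_length u).+1.
Proof.
have le (v : W) : cox_length (gen s * v) <= (cox_length v).+1.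
  rewrite (leq_trans (cox_lengthM _ _)) // -add1n leq_add2r.
  by rewrite -[gen s]mulg1 -cox_val_nil -cox_val_cons cox_length_val.
have := le u; have := le (gen s * u); rewrite cox_genK.
case: (boolP (inversion u _)) => [/inversion_length|]; first lia.
by rewrite -inversion_genM => /inversion_length; rewrite cox_genK; lia.
Qed.

Lemma inversion_lengthE u s :
  inversion u (gen s) = (cox_length (gen s * u) < cox_length u).
Proof.
apply/idP/idP=> [/inversion_length //|].
by rewrite cox_length_genM; case: inversion => //; lia.
Qed.

Lemma cox_length_gen (s : S) : cox_length (gen s) = 1%N.
Proof. by rewrite -[gen s]mulg1 cox_length_genM inversion1 cox_length1. Qed.

(** * Reduced words and additive products *)

Definition reduced (w : seq S) := cox_length (cox_val w) == size w.

Lemma reduced_cox_word u : reduced (cox_word u).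
Proof. by rewrite /reduced cox_wordK size_cox_word. Qed.

Lemma reduced_cat w1 w2 : reduced (w1 ++ w2) -> reduced w1 && reduced w2.
Proof.
rewrite /reduced size_cat cox_val_cat => /eqP e.
have := cox_lengthM (cox_val w1) (cox_val w2).
by have := cox_length_val w1; have := cox_length_val w2; lia.
Qed.

(** If the reflection of the first letter recurs, that letter cancels against a later one.
    Conversely, distinct reflections are all inversions of the value, so they all occur in a
    shortest word for it. *)
Lemma reduced_uniq w : reduced w = uniq (refl_seq w).
Proof.
apply/idP/idP.
  elim: w => //= s w IHw red.
  have /andP[_ redw] := @reduced_cat [:: s] w red.
  rewrite (map_inj_uniq (@conj_gen_inj s)) IHw // andbT; apply/negP.
  rewrite -{1}(conj_genK s (gen s)) (mem_map (@conj_gen_inj s)) cox_gen_sqr mul1g.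
  case/refl_seq_delete => w' [_ sz e]; move: red (cox_length_val w').
  by rewrite /reduced cox_val_cons -e /= sz => /eqP ->; rewrite ltnNge leqnSn.

move=> u; rewrite /reduced eqn_leq cox_length_val /=.
rewrite -size_cox_word -!size_refl_seq; apply: uniq_leq_size => // r rw.
apply: inversion_mem; rewrite cox_wordK inversion_val.
by rewrite count_uniq_mem // rw.
Qed.

Definition additive (u v : W) := cox_length (u * v) == (cox_length u + cox_length v)%N.

(** Concatenating reduced words of u and v lists the reflections of u, then those of v conjugated by
    u. Disjointness of the inversion sets keeps this list free of repetitions. *)
Lemma additive_inversion u v :
  (forall r, inversion u^-1 r -> inversion v r -> False) -> additive u v.
Proof.
move=> disj; rewrite /additive -{1}(cox_wordK u) -{1}(cox_wordK v) -cox_val_cat.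
rewrite -(size_cox_word u) -(size_cox_word v) -size_cat.
change (reduced (cox_word u ++ cox_word v)); rewrite reduced_uniq.
have reflE w1 w2 : refl_seq (w1 ++ w2) = refl_seq w1 ++
    [seq cox_val w1 * r * (cox_val w1)^-1 | r <- refl_seq w2].
  elim: w1 => [|s w1 IH] /=.
    by rewrite cox_val_nil invg1 -[LHS]map_id; apply: eq_map => r; rewrite mul1g mulg1.
  rewrite IH map_cat cox_val_cons -map_comp; congr (_ :: _ ++ _).
  by apply: eq_map => r /=; rewrite invgM cox_gen_inv !mulgA.
rewrite reflE cat_uniq map_inj_uniq => [|r r' /mulIg /mulgI //].
have := reduced_cox_word u; have := reduced_cox_word v; rewrite !reduced_uniq => uv uu.
rewrite uu uv andbT /= cox_wordK; apply/hasPn => r0 /mapP[r rv ->]; apply/negP => ru.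
apply: (disj r).
  by rewrite inversionV -(cox_wordK u) inversion_val cox_wordK count_uniq_mem // ru.
by rewrite -(cox_wordK v) inversion_val count_uniq_mem // rv.
Qed.

End CoxeterActions.

(** * The order of a product of two generators *)

Section TitsRepresentation.
Import GRing.Theory Num.Theory.
Local Open Scope ring_scope.

Lemma tits_parameter (n : nat) : exists q : algC,
  [/\ q != 0, q ^+ n.*2 = 1 & forall k, q ^+ k.*2 = 1 -> (n %| k)%N].
Proof.
case: n => [|n].
  (* The value 0 stands for no relation, so q must not be a root of unity. *)
  exists 2; split=> [||k /eqP]; rewrite ?pnatr_eq0 ?expr0 //.
  by rewrite -natrX pnatr_eq1 -[1%N](expn0 2) eqn_exp2l // double_eq0 => /eqP ->.
have [q prim_q] := C_prim_root_exists (ltn0Sn n.*2.+1).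
exists q; split.
- by apply/eqP=> q0; move: (prim_expr_order prim_q); rewrite q0 expr0n => /eqP;
    rewrite eq_sym oner_eq0.
- exact: prim_expr_order prim_q.
- move=> k /eqP; rewrite -(prim_order_dvd prim_q) -doubleS -!muln2.
  by rewrite dvdn_pmul2r.
Qed.

Variable W : coxeter_group.
Local Notation S := (cox_gens W).

(** The default 0 treats an absent relation as the trivial relation $(st)^0 = 1$; then $q^2$ has
    infinite order. *)
Definition tits_q (s t : S) : algC :=
  projT1 (cid (tits_parameter (odflt 0%N (cox_mx s t)))).

(* The matrix $-2\cos(\pi/m_{st})$, with any primitive $2m_{st}$-th root of unity in place
   of $e^{i\pi/m_{st}}$, and with 2 when there is no relation between [s] and [t]. *)
Definition tits_mx (s t : S) : algC :=
  if s == t then 2 else - (tits_q s t + (tits_q s t)^-1).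

(** The contragredient of the reflection representation: f is a linear form, given by its values on
    the simple roots. *)
Definition tits_act (s : S) (f : S -> algC) (r : S) : algC :=
  f r - tits_mx s r * f s.

Section Rank2.
Variables s t : S.
Hypothesis neq_st : s != t.
Let q := tits_q s t.
Let c := tits_mx s t.

Let q_spec : [/\ q != 0, q ^+ 2 != 1, q ^+ (odflt 0%N (cox_mx s t)).*2 = 1
  & forall k, q ^+ k.*2 = 1 -> (odflt 0%N (cox_mx s t) %| k)%N].
Proof.
rewrite /q /tits_q; case: cid => q0 [q0_neq0 q0n q0_ord] /=; split=> //.
apply/eqP => /(q0_ord 1%N); rewrite dvdn1; move/eqP => m1.
have [] := cox_mx1 s t; move: m1; case: cox_mx => //= m -> /(_ erefl) est.
by move: neq_st; rewrite est eqxx.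
Qed.

Let cE : c = - (q + q^-1). Proof. by rewrite /c /tits_mx (negbTE neq_st). Qed.

Let cEC : tits_mx t s = c.
Proof. by rewrite /c /tits_mx /tits_q cox_mxC eq_sym. Qed.

Let mxss (r : S) : tits_mx r r = 2. Proof. by rewrite /tits_mx eqxx. Qed.

(** Under st, the quantities $f(s) + q f(t)$ and $f(t) + q f(s)$ are multiplied by $q^2$ and
    $q^{-2}$. *)
Lemma tits_iter_eigen k f :
  let g := iter k (tits_act s \o tits_act t) f in
  g s + q * g t = q ^+ k.*2 * (f s + q * f t) /\
  q ^+ k.*2 * (g t + q * g s) = f t + q * f s.
Proof.
have [q0 _ _ _] := q_spec.
elim: k => [|k [IH1 IH2]] /=; first by rewrite !mul1r.
set g := iter k _ f in IH1 IH2 *; rewrite doubleS !exprS -/c.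
rewrite /tits_act !mxss cEC -/c cE; split.
  rewrite -[in RHS]mulrA -[in RHS]mulrA -IH1; by field.
by rewrite -IH2; field.
Qed.

Lemma tits_iter_span k f : exists x y, forall r,
  iter k (tits_act s \o tits_act t) f r = f r - tits_mx s r * x - tits_mx t r * y.
Proof.
elim: k => [|k [x [y IH]]] /=; first by exists 0, 0 => r; rewrite !mulr0 !subr0.
set g := iter k _ f in IH *.
exists (x + tits_act t g s), (y + g t) => r.
by rewrite {1}/tits_act {1}/tits_act IH; ring.
Qed.

(** As $q^{2n} = 1$ and $q^2 \neq 1$, the eigenvalue equations show that f keeps its values at s and
    t. The change of f is a combination of the rows s and t of the matrix, whose coefficients x and
    y then vanish because the determinant $4 - c^2$ is nonzero. *)
Lemma tits_relation n f :
  cox_mx s t = Some n -> iter n (tits_act s \o tits_act t) f = f.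
Proof.
move=> st; have [q0 q2 qn _] := q_spec; rewrite st /= in qn.
have [x [y gE]] := tits_iter_span n f.
have [] := tits_iter_eigen n f; rewrite qn !mul1r !gE !mxss cEC -/c => e1 e2.
have q2' : 1 - q ^+ 2 != 0 by rewrite subr_eq0 eq_sym.
have da : 2 * x + c * y = 0.
  apply: (mulfI q2'); rewrite mulr0.
  have -> : (1 - q ^+ 2) * (2 * x + c * y) =
    q * ((f t - c * x - 2 * y + q * (f s - 2 * x - c * y)) - (f t + q * f s))
    - ((f s - 2 * x - c * y + q * (f t - c * x - 2 * y)) - (f s + q * f t)) by ring.
  by rewrite e1 e2 !subrr mulr0 subrr.
have db : c * x + 2 * y = 0.
  have : (f t - c * x - 2 * y + q * (f s - 2 * x - c * y)) - (f t + q * f s)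
    + q * (2 * x + c * y) = - (c * x + 2 * y) by ring.
  by rewrite e2 da subrr mulr0 addr0 => /eqP; rewrite eq_sym oppr_eq0 => /eqP.
have dc : 4 - c ^+ 2 != 0.
  have -> : 4 - c ^+ 2 = - ((1 - q ^+ 2) / q) ^+ 2 by rewrite cE; field.
  by rewrite oppr_eq0 expf_neq0 // mulf_neq0 // invr_neq0.
have x0 : x = 0.
  apply: (mulfI dc); rewrite mulr0.
  have -> : (4 - c ^+ 2) * x = 2 * (2 * x + c * y) - c * (c * x + 2 * y) by ring.
  by rewrite da db !mulr0 subrr.
have y0 : y = 0.
  apply: (mulfI dc); rewrite mulr0.
  have -> : (4 - c ^+ 2) * y = 2 * (c * x + 2 * y) - c * (2 * x + c * y) by ring.
  by rewrite da db !mulr0 subrr.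
by apply: funext => r; rewrite gE x0 y0 !mulr0 !subr0.
Qed.

End Rank2.

Lemma cox_order_dvd (s t : S) k :
  ((cox_gen s * cox_gen t) ^+ k)%g = 1%g -> (odflt 0%N (cox_mx s t) %| k)%N.
Proof.
have [<-|neq_st] := eqVneq s t.
  by have /(_ erefl) -> := proj2 (cox_mx1 s s); rewrite dvd1n.
rewrite -cox_val_alternating_double -cox_val_nil => /(cox_action (act := tits_act)).
move=> act1; have {}act1 f : iter k (tits_act s \o tits_act t) f = f.
  rewrite iter_comp_foldr act1 // => a b n g.
  have [<-|neq_ab] := eqVneq a b; last exact: tits_relation.
  rewrite (proj2 (cox_mx1 a a) erefl) => -[<-].
  by apply: funext => r /=; rewrite /tits_act /tits_mx eqxx; ring.
(* The form that is 1 at s and 0 at t has $f(s) + q f(t) = 1$, so its invariance reads $q^{2k} =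
   1$. *)
have := tits_iter_eigen neq_st k (fun r => if r == s then 1 else 0).
rewrite /= act1 eqxx eq_sym (negbTE neq_st) mulr0 addr0 mulr1 => -[/esym].
rewrite /tits_q; case: cid => q [_ _ q_ord] /= + _; exact: q_ord.
Qed.

End TitsRepresentation.

(** * Parabolic factorization and Matsumoto's theorem *)

Section WeakOrder.
Variable W : coxeter_group.
Local Notation S := (cox_gens W).
Local Notation gen := (@cox_gen W).
Local Open Scope group_scope.

Lemma additive_assoc (u v w : W) :
  (additive u v && additive (u * v) w) = (additive v w && additive u (v * w)).
Proof.
rewrite /additive mulgA.
have := cox_lengthM u v; have := cox_lengthM v w.
have := cox_lengthM (u * v) w; have := cox_lengthM u (v * w); rewrite mulgA.
move: (cox_length (u * v * w)) (cox_length (u * v)) (cox_length (v * w)) => a b c.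
by move=> *; apply/andP/andP => -[/eqP ? /eqP ?]; split; apply/eqP; lia.
Qed.

Lemma additiveP (u v w : W) : additive u v -> additive (u * v) w ->
  additive v w /\ additive u (v * w).
Proof. by move=> uv uvw; apply/andP; rewrite -additive_assoc uv. Qed.

Lemma additivePV (u v w : W) : additive v w -> additive u (v * w) ->
  additive u v /\ additive (u * v) w.
Proof. by move=> vw uvw; apply/andP; rewrite additive_assoc vw. Qed.

Lemma additive1g (u : W) : additive 1 u.
Proof. by rewrite /additive mul1g cox_length1. Qed.

Lemma additiveg1 (u : W) : additive u 1.
Proof. by rewrite /additive mulg1 cox_length1 addn0. Qed.

Lemma additive_gen (s : S) (u : W) : additive (gen s) u = ~~ inversion u (gen s).
Proof.
rewrite /additive cox_length_gen cox_length_genM add1n.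
by move: (cox_length u) => n; case: inversion => /=; lia.
Qed.

Lemma additiveVgen (u : W) (s : S) : additive u (gen s) = ~~ inversion u^-1 (gen s).
Proof.
rewrite -additive_gen /additive -(cox_lengthV (u * _)) invgM cox_gen_inv.
by rewrite cox_lengthV addnC.
Qed.

Lemma additive_cat (w1 w2 : seq S) :
  reduced (w1 ++ w2) -> additive (cox_val w1) (cox_val w2).
Proof.
move=> r; have /andP[/eqP r1 /eqP r2] := reduced_cat r.
by move: r; rewrite /reduced /additive cox_val_cat size_cat r1 r2.
Qed.

Lemma reduced_additive_cat (w1 w2 : seq S) : reduced w1 -> reduced w2 ->
  additive (cox_val w1) (cox_val w2) -> reduced (w1 ++ w2).
Proof.
by rewrite /reduced /additive cox_val_cat size_cat => /eqP -> /eqP ->.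
Qed.

(** Deletion property. A subword uses no new letters, so the result stays in the same parabolic
    subgroup. *)
Lemma reduced_subword (w : seq S) :
  exists w', [/\ subseq w' w, cox_val w' = cox_val w & reduced w'].
Proof.
elim: w => [|s w [w' [sw' e red]]].
  by exists [::]; rewrite /reduced cox_val_nil cox_length1.
case: (boolP (inversion (cox_val w) (gen s))) => [i|i].
  have := i; rewrite -e => /inversion_mem /refl_seq_delete[w2 [sw2 sz e2]].
  exists w2; rewrite cox_val_cons -e e2; split=> //.
    exact: subseq_trans sw2 (subseq_trans sw' (subseq_cons _ _)).
  by rewrite /reduced e2 cox_length_genM e i -e (eqP red) sz.
exists (s :: w'); rewrite /= eqxx !cox_val_cons e; split=> //.
by rewrite /reduced cox_val_cons cox_length_genM e (negbTE i) -e (eqP red).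
Qed.

(** * Parabolic subgroups *)

Lemma refl_seq_all (p : pred S) (d : seq S) (r : W) : all p d -> r \in refl_seq d ->
  exists2 d', all p d' & cox_val d' = r.
Proof.
elim: d r => //= s d IHd r /andP[ps pd]; rewrite inE => /orP[/eqP ->|/mapP[r' r'd ->]].
  by exists [:: s]; rewrite /= ?ps // cox_val_cons cox_val_nil mulg1.
have [d' pd' <-] := IHd _ pd r'd; exists (s :: d' ++ [:: s]).
  by rewrite /= all_cat ps pd' /= ps.
by rewrite cox_val_cons cox_val_cat cox_val_cons cox_val_nil mulg1 mulgA.
Qed.

(** The inversions of an element of the parabolic subgroup generated by p lie in this subgroup,
    where $a^{-1}$ has none; so the two inversion sets are disjoint. *)
Lemma parabolic_additive (p : pred S) (a : W) (d : seq S) :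
  (forall d', all p d' -> ~~ inversion a^-1 (cox_val d')) ->
  all p d -> additive a (cox_val d).
Proof.
move=> na pd; apply: additive_inversion => r ra /inversion_mem /(refl_seq_all pd)[d' pd' e].
by move: (na d' pd'); rewrite e ra.
Qed.

(** As long as u has an inversion in the parabolic subgroup, that reflection is moved into c and u
    becomes shorter. At the end the inversion sets are disjoint, which gives additivity. *)
Lemma parabolic_factor (p : pred S) (x : W) : exists c u,
  [/\ all p c, reduced c, x = cox_val c * u, additive (cox_val c) u &
      forall d, all p d -> ~~ inversion u (cox_val d)].
Proof.
suff {x} H n c u : all p c -> cox_length u < n -> exists c' u',
    [/\ all p c', reduced c', cox_val c * u = cox_val c' * u', additive (cox_val c') u' &
      forall d, all p d -> ~~ inversion u' (cox_val d)].
  by have := H _ [::] x isT (ltnSn _); rewrite cox_val_nil mul1g.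
elim: n c u => // n IHn c u pc len_u.
have [[d pd du]|nd] := pselect (exists2 d, all p d & inversion u (cox_val d)).
  have -> : cox_val c * u = cox_val (c ++ rev d) * (cox_val d * u).
    by rewrite cox_val_cat cox_val_rev -mulgA mulKg.
  apply: IHn; first by rewrite all_cat pc all_rev.
  exact: leq_trans (inversion_length du) len_u.
have {}nd d : all p d -> ~~ inversion u (cox_val d).
  by move=> pd; apply/negP=> du; apply: nd; exists d.
have [c' [sc' <- redc']] := reduced_subword c.
have pc' : all p c' by apply/allP => s /(mem_subseq sc') /(allP pc).
exists c', u; split=> //.
apply: additive_inversion => r; rewrite -cox_val_rev => /inversion_mem.
by rewrite -all_rev in pc' => /(refl_seq_all pc')[d pd <-]; apply/negP/nd.
Qed.

(** Were the parabolic factor c of x nonempty, its first letter would be a descent of x; so x equals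
    its factor u. *)
Lemma parabolic_ascents (p : pred S) (x : W) :
  (forall s, p s -> ~~ inversion x (gen s)) ->
  forall d, all p d -> ~~ inversion x (cox_val d).
Proof.
move=> nx; have [[|s c] [u [pc red xE add nu]]] := parabolic_factor p x.
  by rewrite xE cox_val_nil mul1g.
have /andP[ps _] := pc; have := nx s ps; rewrite inversion_lengthE.
move: add; rewrite /additive -xE (eqP red) => /eqP ->.
rewrite xE cox_val_cons -!mulgA cox_genK /= -leqNgt => le.
have := leq_trans le (cox_lengthM _ _); have := cox_length_val c.
by rewrite addSn => le1; rewrite ltn_add2r ltnNge le1.
Qed.

(** * Alternating words and braid relations *)

Lemma mulg_alternating (s t : S) n :
  (gen s * gen t) ^+ n * cox_val (alternating t s n) = cox_val (alternating s t n).
Proof.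
elim: n s t => [|n IHn] s t; first by rewrite !cox_val_nil mulg1.
rewrite !alternatingS !cox_val_cons -(IHn t s) !mulgA; congr (_ * _).
elim: n {IHn} => [|n IHn]; first by rewrite expg0 expg1 mulg1 -mulgA cox_gen_sqr mulg1.
by rewrite expgS -mulgA IHn [in RHS]expgS !mulgA.
Qed.

Lemma cox_val_braid (s t : S) n : cox_mx s t = Some n ->
  cox_val (alternating s t n) = cox_val (alternating t s n).
Proof. by move=> st; rewrite -mulg_alternating cox_gen_expg // mul1g. Qed.

(** The reflections $(st)^i s$ with i < n are distinct because no power $(st)^k$ with 0 < k < n is
    1. *)
Lemma reduced_alternating (s t : S) n : s <> t -> cox_mx s t = Some n ->
  reduced (alternating s t n).
Proof.
move=> neq_st st; rewrite reduced_uniq refl_seq_alternating.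
rewrite map_inj_in_uniq ?iota_uniq // => i j; rewrite !mem_iota add0n /= => i_n j_n.
wlog ij : i j i_n j_n / i <= j.
  by move=> IH; case: (leqP i j) => [|/ltnW] ij e; [|apply/esym]; apply: IH.
move=> /mulIg e; apply/eqP; rewrite eqn_leq ij /= -subn_eq0.
have /cox_order_dvd : (gen s * gen t) ^+ (j - i) = 1 by rewrite expgnFr // e mulgV.
rewrite st /=; case: (j - i) (leq_subr i j) => // k kj /dvdn_leq => /(_ isT).
by rewrite leqNgt (leq_ltn_trans kj j_n).
Qed.

Lemma reduced_rank2 (s t : S) c : all (pred2 s t) c -> reduced c ->
  c = alternating s t (size c) \/ c = alternating t s (size c).
Proof.
elim: c => [|a c IHc] /=; first by left.
have nred (b : S) d : ~~ reduced (b :: b :: d).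
  apply/negP => /(@reduced_cat _ [:: b; b])/andP[].
  by rewrite /reduced !cox_val_cons cox_val_nil mulg1 cox_gen_sqr cox_length1.
move=> /andP[a_st c_st] red; have /andP[_ redc] := @reduced_cat _ [:: a] c red.
rewrite !alternatingS.
case/orP: a_st red => /eqP -> red; [left | right];
  case: (IHc c_st redc) => e; rewrite -?e //;
  case: (c) e red => // b d; rewrite alternatingS => -[-> _]; by rewrite (negbTE (nred _ _)).
Qed.

(** If t equals a reflection $(st)^i s$ with i < k, then $(st)^{i+1} = 1$, so $m_{st}$ is finite,
    positive and divides i + 1. *)
Lemma alternating_inversion (s t : S) k :
  inversion (cox_val (alternating s t k)) (gen t) ->
  exists m, [/\ cox_mx s t = Some m, 0 < m & m <= k].
Proof.
move/inversion_mem; rewrite refl_seq_alternating => /mapP[i].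
rewrite mem_iota add0n /= => ik e.
have /cox_order_dvd : (gen s * gen t) ^+ i.+1 = 1.
  by rewrite expgSr mulgA -e cox_gen_sqr.
case: cox_mx => /= [[|m]|]; rewrite ?dvd0n // => /dvdn_leq le.
by exists m.+1; split=> //; apply: leq_trans (le _) ik.
Qed.

(* This is where the order of $st$ being exactly $m_{st}$ matters. *)
Lemma inversion_braid (x : W) (s t : S) : s <> t ->
  inversion x (gen s) -> inversion x (gen t) ->
  exists m u, [/\ cox_mx s t = Some m.+1, reduced (alternating s t m.+1),
    x = cox_val (alternating s t m.+1) * u &
    additive (cox_val (alternating s t m.+1)) u].
Proof.
move=> neq_st xs xt.
have [c [u [pc red xE add nu]]] := parabolic_factor (pred2 s t) x.
have cx r : (r == s) || (r == t) -> inversion x (gen r) -> inversion (cox_val c) (gen r).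
  move=> r_st; rewrite xE inversionM.
  (* The word [rev c ++ r :: c] spells $c^{-1} r c$, which is not an inversion of u; so r is an
     inversion of c itself. *)
  have := nu (rev c ++ r :: c); rewrite all_cat all_rev pc /= r_st pc.
  by rewrite cox_val_cat cox_val_rev cox_val_cons mulgA => /(_ isT)/negbTE ->; rewrite addbF.
have cs : inversion (cox_val c) (gen s) by apply: cx xs; rewrite eqxx.
have ct : inversion (cox_val c) (gen t) by apply: cx xt; rewrite eqxx orbT.
have key a b : c = alternating a b (size c) -> inversion (cox_val c) (gen b) ->
  exists m u, [/\ cox_mx a b = Some m.+1, reduced (alternating a b m.+1),
    x = cox_val (alternating a b m.+1) * u &
    additive (cox_val (alternating a b m.+1)) u].
  move=> cE; rewrite {1}cE => /alternating_inversion[[|m] [ab // _ mc]].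
  have [d dE] := alternatingD a b m.+1 (size c - m.+1).
  rewrite subnKC // -cE in dE.
  have redc := red; rewrite dE in redc.
  have /andP[redm _] := reduced_cat redc.
  exists m, (cox_val d * u); split=> //; first by rewrite mulgA -cox_val_cat -dE.
  by apply: (additiveP (additive_cat redc) _).2; rewrite -cox_val_cat -dE.
have [cE|cE] := reduced_rank2 pc red; first exact: key cE ct.
have [m [u' [ts redm xE' add']]] := key _ _ cE cs.
rewrite cox_mxC in ts; exists m, u'; rewrite ts.
have e := cox_val_braid ts; rewrite -e in redm xE' add'; split=> //.
by move: redm; rewrite /reduced -e !size_alternating.
Qed.

(** Induction on the common length. If the first letters s and t differ, both are descents of the
    value, which then begins with the braid word of s and t. Two intermediate words, beginning with
    s and with t, differ by that one braid relation, and induction applies behind the first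
    letters. *)
Lemma matsumoto (w w' : seq S) : reduced w -> reduced w' -> cox_val w = cox_val w' ->
  @pres_eq (artin_polygraph W) tt tt (word_path w) (word_path w').
Proof.
have congS s (a b : seq S) : @pres_eq (artin_polygraph W) tt tt (word_path a) (word_path b) ->
    @pres_eq (artin_polygraph W) tt tt (word_path (s :: a)) (word_path (s :: b)).
  move=> ab; have -> : word_path (s :: a) = pcat (word_path [:: s]) (word_path a) by [].
  have -> : word_path (s :: b) = pcat (word_path [:: s]) (word_path b) by [].
  exact: pres_eq_cat (pres_eq_refl _) ab.
move=> rw rw' e; have : size w = size w' by rewrite -(eqP rw) e (eqP rw').
move: {2}(size w) (erefl (size w)) => n.
elim: n w w' rw rw' e => [|n IHn] [|s w] [|t w'] // rw rw' e.
  by move=> *; apply: pres_eq_refl.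
move=> [szw] [szw'].
have redcons a (d : seq S) : reduced (a :: d) -> reduced d /\ inversion (cox_val (a :: d)) (gen a).
  move=> r; have /andP[_ rd] := @reduced_cat _ [:: a] d r; split=> //.
  rewrite inversion_lengthE (eqP r) cox_val_cons cox_genK ltnS; exact: cox_length_val.
have [redw xs] := redcons _ _ rw; have [redw' xt] := redcons _ _ rw'.
have [st|neq_st] := pselect (s = t).
  subst t; apply: congS; apply: IHn; rewrite -?szw' //.
  by move: e; rewrite !cox_val_cons => /mulgI.
rewrite -e in xt.
have [m [u [st redm xE add]]] := inversion_braid neq_st xs xt.
pose d a b := alternating a b m ++ cox_word u.
have dE a b : b :: d a b = alternating b a m.+1 ++ cox_word u by rewrite /d alternatingS.
have braid := cox_val_braid st.
have redst : reduced (s :: d t s).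
  rewrite dE; apply: reduced_additive_cat => //; first exact: reduced_cox_word.
  by rewrite cox_wordK.
have valst : cox_val (s :: d t s) = cox_val (s :: w) by rewrite dE cox_val_cat cox_wordK xE.
have valts : cox_val (t :: d s t) = cox_val (t :: w').
  by rewrite -e -valst !dE !cox_val_cat braid.
have szd : size (d t s) = n.
  by have := eqP rw; rewrite -valst (eqP redst) /= szw => -[].
have szd' : size (d s t) = n by rewrite -szd /d !size_cat !size_alternating.
have redts : reduced (t :: d s t).
  by rewrite /reduced valts -e (eqP rw) /= szw szd'.
apply: (@pres_eq_trans (artin_polygraph W) tt tt _ (word_path (s :: d t s))).
  apply: congS; apply: IHn; rewrite ?szd //; first by case: (redcons _ _ redst).
  by move: valst; rewrite !cox_val_cons => /mulgI.
apply: (@pres_eq_trans (artin_polygraph W) tt tt _ (word_path (t :: d s t))).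
  rewrite !dE !word_path_cat; apply: pres_eq_cat; last exact: pres_eq_refl.
  exact: (@pres_eq_cell (artin_polygraph W) (BraidRel neq_st st)).
apply: congS; apply: IHn; rewrite ?szd' -?szw' //; first by case: (redcons _ _ redts).
by move: valts; rewrite !cox_val_cons => /mulgI.
Qed.

End WeakOrder.

(** * Greedy splitting in the weak order *)

Section GreedySplitting.
Variable W : coxeter_group.
Local Notation S := (cox_gens W).
Local Notation gen := (@cox_gen W).
Local Open Scope group_scope.

Definition wprefix (y x : W) := additive y (y^-1 * x).

Lemma wprefixP y x : reflect (exists2 z, x = y * z & additive y z) (wprefix y x).
Proof.
apply: (iffP idP) => [yx|[z -> yz]]; first by exists (y^-1 * x); rewrite ?mulVKg.
by rewrite /wprefix mulKg.
Qed.

Lemma wprefix_trans y x z : wprefix x y -> wprefix y z -> wprefix x z.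
Proof.
move=> /wprefixP[u -> xu] /wprefixP[v -> xuv]; apply/wprefixP.
by have [uv xuv'] := additiveP xu xuv; exists (u * v); rewrite ?mulgA.
Qed.

Lemma wprefixxx x : wprefix x x.
Proof. by rewrite /wprefix mulVg additiveg1. Qed.

Lemma wprefix1g x : wprefix 1 x.
Proof. exact: additive1g. Qed.

Lemma wprefix_length y x : wprefix y x -> cox_length x = (cox_length y + cox_length (y^-1 * x))%N.
Proof. by move/eqP; rewrite mulVKg. Qed.

Lemma wprefix_leq y x : wprefix y x -> cox_length y <= cox_length x.
Proof. by move/wprefix_length->; rewrite leq_addr. Qed.

Lemma wprefix_anti y x : wprefix y x -> wprefix x y -> y = x.
Proof.
move=> yx xy; have /eqP := wprefix_length yx.
have -> : cox_length y = cox_length x by apply/eqP; rewrite eqn_leq !wprefix_leq.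
rewrite -{1}[cox_length x]addn0 eqn_add2l eq_sym length_eq0 => /eqP e.
by rewrite -(mulVKg y x) e mulg1.
Qed.

Lemma additive_wprefix a y x : additive a x -> wprefix y x -> additive a y.
Proof. by move=> ax /wprefixP[z xE yz]; rewrite xE in ax; case: (additivePV yz ax). Qed.

Lemma wprefix_mul2 a y x : additive a x -> wprefix y x -> wprefix (a * y) (a * x).
Proof.
move=> ax /wprefixP[z xE yz]; apply/wprefixP; exists z; first by rewrite xE mulgA.
by rewrite xE in ax; case: (additivePV yz ax).
Qed.

Lemma wprefix_mul2V a y x : additive a x -> additive a y -> wprefix (a * y) (a * x) -> wprefix y x.
Proof.
move=> ax ay /wprefixP[z e ayz]; apply/wprefixP; exists z.
  by apply: (mulgI a); rewrite e mulgA.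
by case: (additiveP ay ayz).
Qed.

Lemma wprefix_first y x : wprefix y x ->
  y = x \/ exists2 s, additive y (gen s) & wprefix (y * gen s) x.
Proof.
case/wprefixP => z -> yz; case e: (cox_word z) (cox_wordK z) => [|s w] zE.
  by left; rewrite -zE cox_val_nil mulg1.
right; exists s.
  apply: additive_wprefix yz _; apply/wprefixP; exists (cox_val w).
    by rewrite -zE cox_val_cons.
  have := reduced_cox_word z; rewrite e => /(@additive_cat _ [:: s] w).
  by rewrite cox_val_cons cox_val_nil mulg1.
apply: wprefix_mul2 => //; apply/wprefixP; exists (cox_val w).
  by rewrite -zE cox_val_cons.
have := reduced_cox_word z; rewrite e => /(@additive_cat _ [:: s] w).
by rewrite cox_val_cons cox_val_nil mulg1.
Qed.

Lemma wprefix_inversion y x s : wprefix y x -> additive y (gen s) ->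
  wprefix (y * gen s) x -> inversion (y^-1 * x) (gen s).
Proof.
move=> /wprefix_length e /eqP e1 /wprefix_length.
rewrite e e1 cox_length_gen invgM cox_gen_inv -mulgA -addnA => /addnI.
by rewrite inversion_lengthE add1n => ->.
Qed.

Section Newman.
Variables a x : W.

Definition left_reduced (y : W) := wprefix y x && additive a y.

Lemma left_reduced_wprefix y z : wprefix y z -> left_reduced z -> left_reduced y.
Proof.
by move=> yz /andP[zx az]; rewrite /left_reduced (wprefix_trans yz zx) (additive_wprefix az yz).
Qed.

(** Both s and t are inversions of $y^{-1}x$, so the longest element of the dihedral subgroup they
    generate can be appended to y within x. As ay has neither s nor t as a right descent, it is
    additive with that whole subgroup. *)
Lemma left_reduced_join y s t : left_reduced y -> s <> t ->
  additive y (gen s) -> left_reduced (y * gen s) ->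
  additive y (gen t) -> left_reduced (y * gen t) ->
  exists2 z, left_reduced z & wprefix (y * gen s) z /\ wprefix (y * gen t) z.
Proof.
move=> /andP[yx ay] neq_st ys /andP[ysx ays] yt /andP[ytx ayt].
have xs := wprefix_inversion yx ys ysx; have xt := wprefix_inversion yx yt ytx.
have [m [u [st red xE add]]] := inversion_braid neq_st xs xt.
have braid := cox_val_braid st.
have [yd ydu] : additive y (cox_val (alternating s t m.+1)) /\
    additive (y * cox_val (alternating s t m.+1)) u.
  by apply: additivePV add _; rewrite -xE.
exists (y * cox_val (alternating s t m.+1)).
  apply/andP; split; first by apply/wprefixP; exists u; rewrite // -mulgA -xE mulVKg.
  apply: (additiveP ay _).2; apply: (@parabolic_additive _ (pred2 s t)).
    apply: parabolic_ascents => r /orP[]/eqP->; rewrite -additiveVgen.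
      by case: (additivePV ys ays).
    by case: (additivePV yt ayt).
  by apply/allP => r /mapP[i _ ->] /=; case: (odd i); rewrite eqxx ?orbT.
split; apply: wprefix_mul2 => //; last rewrite braid; rewrite alternatingS cox_val_cons;
  apply/wprefixP; eexists; [by [] | | by [] | ].
  have := red; rewrite alternatingS => /(@additive_cat _ [:: s]).
  by rewrite cox_val_cons cox_val_nil mulg1.
have : reduced (alternating t s m.+1).
  by move: red; rewrite /reduced braid !size_alternating.
rewrite alternatingS => /(@additive_cat _ [:: t]).
by rewrite cox_val_cons cox_val_nil mulg1.
Qed.

(* Newman's lemma for right multiplication by generators inside the left reduced
   prefixes: local confluence is [left_reduced_join]. *)
Lemma left_reduced_max y : left_reduced y ->
  exists m, [/\ left_reduced m, wprefix y m &
    forall y', left_reduced y' -> wprefix y y' -> wprefix y' m].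
Proof.
move: {2}(cox_length x - cox_length y).+1 (leqnn (cox_length x - cox_length y).+1) => n.
elim: n y => // n IHn y le ly.
have step s : additive y (gen s) -> left_reduced (y * gen s) ->
  exists m, [/\ left_reduced m, wprefix (y * gen s) m &
    forall y', left_reduced y' -> wprefix (y * gen s) y' -> wprefix y' m].
  move=> ys lys; apply: IHn => //; have /andP[/wprefix_leq] := lys.
  rewrite (eqP ys) cox_length_gen => + _; move: le.
  by move: (cox_length x) (cox_length y) => p q; lia.
have yys s : additive y (gen s) -> wprefix y (y * gen s).
  by move=> ys; apply/wprefixP; exists (gen s).
case: (boolP [exists s, additive y (gen s) && left_reduced (y * gen s)]); last first.
  move/existsPn => none; exists y; split=> //; first exact: wprefixxx.
  move=> y' ly' /wprefix_first[<-|[s ys ysy']]; first exact: wprefixxx.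
  by move: (none s); rewrite ys (left_reduced_wprefix ysy' ly').
case/existsP => s /andP[ys lys]; have [m [lm ysm maxm]] := step s ys lys.
exists m; split=> //; first exact: wprefix_trans (yys s ys) ysm.
move=> y' ly' /wprefix_first[<-|[t yt yty']]; first exact: wprefix_trans (yys s ys) ysm.
have [ts|/eqP neq_ts] := eqVneq t s; first by apply: maxm; rewrite // -ts.
have lyt := left_reduced_wprefix yty' ly'.
have [m' [lm' ytm' maxm']] := step t yt lyt.
have [z lz [ysz ytz]] := left_reduced_join ly (nesym neq_ts) ys lys yt lyt.
(* The element z lies between ys and m', so m' is above ys and hence below m. *)
apply: wprefix_trans (maxm' _ ly' yty') (maxm _ lm' _).
exact: wprefix_trans ysz (maxm' _ lz ytz).
Qed.

Lemma greedy_ex : exists y, left_reduced y /\ forall y', left_reduced y' -> wprefix y' y.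
Proof.
have [|m [lm _ maxm]] := @left_reduced_max 1; first by rewrite /left_reduced wprefix1g additiveg1.
by exists m; split=> // y ly; apply: maxm => //; apply: wprefix1g.
Qed.

Definition greedy : W := projT1 (cid greedy_ex).

Lemma greedy_wprefix : wprefix greedy x.
Proof. by rewrite /greedy; case: cid => y [ly _] /=; case/andP: ly. Qed.

Lemma greedy_additive : additive a greedy.
Proof. by rewrite /greedy; case: cid => y [ly _] /=; case/andP: ly. Qed.

Lemma greedy_max y : wprefix y x -> additive a y -> wprefix y greedy.
Proof.
by move=> yx ay; rewrite /greedy; case: cid => m [_ maxm] /=; apply: maxm; rewrite /left_reduced yx.
Qed.

End Newman.

Lemma greedy_id a x : additive a x -> greedy a x = x.
Proof.
move=> ax; apply: wprefix_anti (greedy_wprefix _ _) _.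
by apply: greedy_max => //; apply: wprefixxx.
Qed.

Lemma greedy1 x : greedy 1 x = x.
Proof. exact: greedy_id (additive1g x). Qed.

(** The element b is itself a prefix of [b * greedy b x] that is additive with a; the larger such
    prefixes are the products by with y a prefix of x additive with ab. Maximality on both sides
    gives equality. *)
Lemma greedyM a b x : additive a b ->
  greedy a (b * greedy b x) = b * greedy (a * b) x.
Proof.
move=> ab; have bx := greedy_additive b x.
have abx := greedy_additive (a * b) x.
have [bab abab] := additiveP ab abx.
have b_pre : wprefix b (greedy a (b * greedy b x)).
  by apply: greedy_max => //; apply/wprefixP; exists (greedy b x).
have [y yE by_] := wprefixP _ _ b_pre.
have yx : wprefix y (greedy b x).
  by apply: (wprefix_mul2V bx by_); rewrite -yE; apply: greedy_wprefix.
have aby : additive (a * b) y.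
  by have := greedy_additive a (b * greedy b x); rewrite yE => /(additivePV by_)[].
apply: wprefix_anti; last first.
  apply: greedy_max => //; apply: wprefix_mul2 => //.
  by apply: greedy_max => //; apply: greedy_wprefix.
rewrite yE; apply: wprefix_mul2 => //; apply: greedy_max => //.
exact: wprefix_trans yx (greedy_wprefix _ _).
Qed.

End GreedySplitting.

(** * Normal forms of Garside words *)

Section GarsideNormalForm.
Variable W : coxeter_group.
Local Open Scope group_scope.

Local Notation gar_eq w w' := (@pres_eq (Gar2 W) tt tt (word_path w) (word_path w')).

(** The identity becomes the empty word, so splittings with a trivial factor need no separate
    treatment. *)
Definition letter (u : W) : seq (gar1 W) :=
  if insub u is Some a then [:: a : {u : W | u != 1}] else [::].

Lemma letter1 : letter 1 = [::].
Proof. by rewrite /letter insubF ?eqxx. Qed.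

Lemma letter_val (a : gar1 W) : letter (sval a) = [:: a].
Proof. by rewrite /letter valK. Qed.

Lemma letterN1 (u : W) : u != 1 -> exists2 a, letter u = [:: a] & sval a = u.
Proof. by move=> u1; exists (exist _ u u1) => //; rewrite -letter_val. Qed.

Fixpoint gar_lmul (a : W) (n : seq (gar1 W)) : seq (gar1 W) :=
  if n is x :: n' then
    letter (a * greedy a (sval x)) ++ gar_lmul ((greedy a (sval x))^-1 * sval x) n'
  else letter a.

Lemma additive_eq1 (u v : W) : additive u v -> (u * v == 1) = (u == 1) && (v == 1).
Proof. by rewrite -!length_eq0 => /eqP ->; rewrite addn_eq0. Qed.

(** This makes the normal form invariant under $\alpha_{a,b}$. The heads agree by [greedyM]. The
    prefix y' of x taken for ab is a prefix of the one, y, taken for b; so the part of y beyond y'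
    and the rest of x are additive, and induction applies to the tail. *)
Lemma gar_lmulM a b n : additive a b -> gar_lmul a (gar_lmul b n) = gar_lmul (a * b) n.
Proof.
elim: n a b => [|x n IHn] a b ab /=.
  have [->|/letterN1[c -> cb]] := eqVneq b 1; first by rewrite letter1 mulg1.
  by rewrite /= cb (greedy_id ab) mulVg letter1 cats0.
have bx := greedy_additive b (sval x); set y := greedy b _ in bx *.
have by1 : b * y != 1.
  rewrite additive_eq1 //; apply/negP => /andP[/eqP b1]; rewrite /y b1 greedy1.
  by rewrite (negbTE (svalP x)).
have [c -> cE] := letterN1 by1; rewrite /= cE greedyM // mulgA; congr (_ ++ _).
set y' := greedy (a * b) _; rewrite invgM -mulgA mulKg.
have y'x : wprefix y' (sval x) := greedy_wprefix _ _.
have yx : wprefix y (sval x) := greedy_wprefix _ _.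
have y'y : wprefix y' y.
  apply: greedy_max => //; apply: (additiveP ab _).1.
  exact: greedy_additive.
have [/wprefixP[z yE y'z] /wprefixP[z' xE yz']] := (y'y, yx).
rewrite xE yE mulKg -!mulgA !mulKg mulgA mulKg IHn //.
by rewrite yE in yz'; case: (additiveP y'z yz').
Qed.

Definition gar_nf (w : seq (gar1 W)) : seq (gar1 W) :=
  foldr (fun x n => gar_lmul (sval x) n) [::] w.

Lemma gar_eq_cat w1 w1' w2 w2' : gar_eq w1 w1' -> gar_eq w2 w2' ->
  gar_eq (w1 ++ w2) (w1' ++ w2').
Proof. by rewrite !word_path_cat; apply: pres_eq_cat. Qed.

Lemma gar_eq_letterM u v : additive u v -> gar_eq (letter u ++ letter v) (letter (u * v)).
Proof.
have [->|/letterN1[a -> <-]] := eqVneq u 1.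
  by rewrite letter1 mul1g => _; apply: pres_eq_refl.
have [->|/letterN1[b -> <-]] := eqVneq v 1.
  by rewrite letter1 mulg1 letter_val => _; apply: pres_eq_refl.
move=> /eqP ab; rewrite -[sval a * sval b]/(sval (gar_mul (GarCell2 ab))) letter_val.
exact: (@pres_eq_cell (Gar2 W) (GarCell2 ab)).
Qed.

Lemma gar_eq_lmul a n : gar_eq (letter a ++ n) (gar_lmul a n).
Proof.
elim: n a => [|x n IHn] a /=; first by rewrite cats0; apply: pres_eq_refl.
set y := greedy a _; have yx : wprefix y (sval x) := greedy_wprefix _ _.
apply: (@pres_eq_trans (Gar2 W) tt tt _
  (word_path (letter a ++ (letter y ++ letter (y^-1 * sval x)) ++ n))).
  rewrite -cat1s -letter_val; apply: gar_eq_cat; first exact: pres_eq_refl.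
  apply: gar_eq_cat; last exact: pres_eq_refl.
  by apply: pres_eq_sym; have := gar_eq_letterM yx; rewrite mulVKg.
rewrite -catA catA; apply: gar_eq_cat (IHn _).
exact: gar_eq_letterM (greedy_additive _ _).
Qed.

Lemma gar_eq_nf w : gar_eq w (gar_nf w).
Proof.
elim: w => [|x w IHw]; first exact: pres_eq_refl.
apply: pres_eq_trans _ (gar_eq_lmul _ _); rewrite letter_val.
exact: (@gar_eq_cat [:: x] [:: x] _ _ (pres_eq_refl _) IHw).
Qed.

Lemma gar_nf_cat w w' : gar_nf (w ++ w') = foldr (fun x n => gar_lmul (sval x) n) (gar_nf w') w.
Proof. exact: foldr_cat. Qed.

(** The recipe for standard reductions: the tail is brought to y followed by r, and y is then merged
    into x. Here y is the greedy prefix of the first letter of the normal form of w, or 1 if that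
    form is empty. *)
Lemma gar_nf_head x w : exists m r y, [/\ gar_nf (x :: w) = m :: r,
  sval m = sval x * y, additive (sval x) y & gar_eq w (letter y ++ r)].
Proof.
rewrite /=; have := gar_eq_nf w; case: (gar_nf w) => [|x1 n] wn /=.
  exists x, [::], 1; rewrite mulg1 letter1 letter_val; split=> //; exact: additiveg1.
set y := greedy _ _; have xy : additive (sval x) y := greedy_additive _ _.
have xy1 : sval x * y != 1 by rewrite additive_eq1 // (negbTE (svalP x)).
have [m -> mE] := letterN1 xy1.
exists m, (gar_lmul (y^-1 * sval x1) n), y; split=> //.
apply: pres_eq_trans wn _.
have yx : wprefix y (sval x1) := greedy_wprefix _ _.
apply: (@pres_eq_trans (Gar2 W) tt tt _
  (word_path (letter y ++ letter (y^-1 * sval x1) ++ n))).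
  rewrite -cat1s catA -letter_val; apply: gar_eq_cat; last exact: pres_eq_refl.
  by apply: pres_eq_sym; have := gar_eq_letterM yx; rewrite mulVKg.
by apply: gar_eq_cat; [apply: pres_eq_refl | apply: gar_eq_lmul].
Qed.

End GarsideNormalForm.

(** * The monoid presented by Garside's presentation *)

Section PresentedFunctor.
Variables (P P' : polygraph2) (h0 : cell0 P -> cell0 P').
Variable h : forall x y, gpath x y -> gpath (h0 x) (h0 y).
Hypotheses (h_nil : forall x, h (pnil x) = pnil (h0 x))
  (h_cat : forall x y z (f : gpath x y) (g : gpath y z), h (pcat f g) = pcat (h f) (h g))
  (h_cell : forall a : cell2 P, pres_eq (h (src21 a)) (h (tgt21 a))).

Lemma pres_eq_map x y (f g : gpath x y) : pres_eq f g -> pres_eq (h f) (h g).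
Proof.
elim=> {x y f g} [a|x y f|x y f g _ IH|x y f g k _ IH1 _ IH2|x y z f f' g g' _ IH1 _ IH2].
- exact: h_cell.
- exact: pres_eq_refl.
- exact: pres_eq_sym.
- exact: pres_eq_trans IH1 IH2.
- by rewrite !h_cat; apply: pres_eq_cat.
Qed.

Definition pres_map x y (X : pres_hom x y) : pres_hom (h0 x) (h0 y) :=
  pres_class (h (quot_repr X)).

Lemma pres_mapE x y (f : gpath x y) : pres_map (pres_class f) = pres_class (h f).
Proof. by apply/pres_classP/pres_eq_map/pres_classP/pres_reprK. Qed.

Lemma pres_map1 x : pres_map (pres_class (pnil x)) = pres_class (pnil (h0 x)).
Proof. by rewrite pres_mapE h_nil. Qed.

Lemma pres_mapM x y z (X : pres_hom x y) (Y : pres_hom y z) :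
  pres_map (pres_comp X Y) = pres_comp (pres_map X) (pres_map Y).
Proof.
by rewrite -[X]pres_reprK -[Y]pres_reprK pres_compE !pres_mapE pres_compE h_cat.
Qed.

Definition pres_functor : functor (presented_category P) (presented_category P') :=
  @Functor (presented_category P) (presented_category P') h0 pres_map pres_map1 pres_mapM.

End PresentedFunctor.

Lemma functor_eq_id (C : category) (F : forall x y : ob C, hom x y -> hom x y) F1 FM :
  (forall x y f, F x y f = f) -> @Functor C C (fun x => x) F F1 FM = functor_id C.
Proof.
move=> FE; have eF : F = fun _ _ f => f.
  by apply: functional_extensionality_dep => x; apply: functional_extensionality_dep => y;
    apply: funext => f.
subst F; congr Functor; exact: Prop_irrelevance.
Qed.

Fixpoint word_map A B (phi : A -> seq B) (x y : unit) (f : @gpath (bouquet A) x y) :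
    @gpath (bouquet B) x y :=
  match f in gpath x y return @gpath (bouquet B) x y with
  | pnil x => @pnil (bouquet B) x
  | pcons a z f' => @pcat (bouquet B) tt tt z (word_path (phi a)) (word_map phi f')
  end.

Lemma word_map_cat A B (phi : A -> seq B) (x y z : unit)
    (f : @gpath (bouquet A) x y) (g : @gpath (bouquet A) y z) :
  word_map phi (pcat f g) = pcat (word_map phi f) (word_map phi g).
Proof. by elim: f g => //= a z' f IHf g; rewrite IHf pcatA. Qed.

Lemma word_map_path A B (phi : A -> seq B) w :
  word_map phi (word_path w) = word_path (flatten (map phi w)).
Proof. by elim: w => //= a w ->; rewrite word_path_cat. Qed.

(** * Translations between braid words and Garside words *)

Section GarsidePresentsArtin.
Variable W : coxeter_group.
Local Open Scope group_scope.

Local Notation gar_eq w w' := (@pres_eq (Gar2 W) tt tt (word_path w) (word_path w')).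
Local Notation art_eq w w' :=
  (@pres_eq (artin_polygraph W) tt tt (word_path w) (word_path w')).

Definition gar_to_art (u : gar1 W) : seq (cox_gens W) := cox_word (sval u).
Definition art_to_gar (s : cox_gens W) : seq (gar1 W) := letter (cox_gen s).

Lemma flatten_art_to_gar w : reduced w ->
  gar_eq (flatten (map art_to_gar w)) (letter (cox_val w)).
Proof.
elim: w => [_|s w IHw red] /=; first by rewrite cox_val_nil letter1; apply: pres_eq_refl.
have /andP[_ redw] := @reduced_cat _ [:: s] w red.
rewrite cox_val_cons; apply: (@pres_eq_trans (Gar2 W) tt tt _
  (word_path (letter (cox_gen s) ++ letter (cox_val w)))).
  exact: gar_eq_cat (pres_eq_refl _) (IHw redw).
apply: gar_eq_letterM; have := @additive_cat _ [:: s] w red.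
by rewrite cox_val_cons cox_val_nil mulg1.
Qed.

(** Both sides are reduced words of the same element, so both merge into the same word. *)
Lemma art_to_gar_cell (r : braid_rel W) :
  @pres_eq (Gar2 W) tt tt
    (word_map art_to_gar (word_path (alternating (br_s r) (br_t r) (br_n r))))
    (word_map art_to_gar (word_path (alternating (br_t r) (br_s r) (br_n r)))).
Proof.
case: r => s t n neq_st st /=; rewrite !word_map_path.
have e := cox_val_braid st.
have red := reduced_alternating neq_st st.
apply: pres_eq_trans (flatten_art_to_gar red) _.
rewrite e; apply/pres_eq_sym/flatten_art_to_gar.
by move: red; rewrite /reduced e !size_alternating.
Qed.

Lemma gar_to_art_cell (a : gar_cell2 W) :
  @pres_eq (artin_polygraph W) tt tt
    (word_map gar_to_art (word_path [:: g2u a; g2v a]))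
    (word_map gar_to_art (word_path [:: gar_mul a])).
Proof.
rewrite !word_map_path /= !cats0; have /eqP add := g2_len a; apply: matsumoto.
- by apply: reduced_additive_cat; rewrite ?reduced_cox_word // !cox_wordK.
- exact: reduced_cox_word.
- by rewrite cox_val_cat !cox_wordK.
Qed.

Lemma gar_to_artK x y (f : @gpath (bouquet (gar1 W)) x y) :
  @pres_eq (Gar2 W) x y (word_map art_to_gar (word_map gar_to_art f)) f.
Proof.
elim: f => [z|u z f IHf] /=; first exact: pres_eq_refl.
rewrite word_map_cat word_map_path.
apply: (@pres_eq_cat (Gar2 W) tt tt z _ (word_path [:: u]) _ f) IHf.
have := flatten_art_to_gar (reduced_cox_word (sval u)).
by rewrite cox_wordK letter_val.
Qed.

Lemma art_to_garK x y (f : @gpath (bouquet (cox_gens W)) x y) :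
  @pres_eq (artin_polygraph W) x y (word_map gar_to_art (word_map art_to_gar f)) f.
Proof.
elim: f => [z|s z f IHf] /=; first exact: pres_eq_refl.
rewrite word_map_cat word_map_path.
apply: (@pres_eq_cat (artin_polygraph W) tt tt z _ (word_path [:: s]) _ f) IHf.
have s1 : cox_gen s != 1 by rewrite -length_eq0 cox_length_gen.
rewrite /art_to_gar; have [u -> uE] := letterN1 s1.
rewrite /= cats0; apply: (@matsumoto _ _ [:: s]); first exact: reduced_cox_word.
  by rewrite /reduced cox_val_cons cox_val_nil mulg1 cox_length_gen.
by rewrite /gar_to_art cox_wordK uE cox_val_cons cox_val_nil mulg1.
Qed.

Lemma Gar2_presents_artin : isomorphic (presented_category (Gar2 W)) (artin_monoid W).
Proof.
have nil A B (phi : A -> seq B) x : word_map phi (@pnil (bouquet A) x) = @pnil (bouquet B) x by [].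
exists (@pres_functor (Gar2 W) (artin_polygraph W) (fun x => x) (word_map gar_to_art)
  (nil _ _ _) (@word_map_cat _ _ _) gar_to_art_cell).
exists (@pres_functor (artin_polygraph W) (Gar2 W) (fun x => x) (word_map art_to_gar)
  (nil _ _ _) (@word_map_cat _ _ _) art_to_gar_cell).
split; apply: functor_eq_id => x y X /=; rewrite -[X]pres_reprK.
- rewrite pres_mapE; [|exact: word_map_cat|exact: gar_to_art_cell].
  rewrite pres_mapE; [|exact: word_map_cat|exact: art_to_gar_cell].
  by apply/pres_classP/gar_to_artK.
- rewrite pres_mapE; [|exact: word_map_cat|exact: art_to_gar_cell].
  rewrite pres_mapE; [|exact: word_map_cat|exact: gar_to_art_cell].
  by apply/pres_classP/art_to_garK.
Qed.

End GarsidePresentsArtin.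

(** * Contracting a (2,1)-category *)

Section HeterogeneousEquality.
Variable P : polygraph31.

(* Equality of 2-cells whose boundaries are only propositionally equal. *)
Definition heq21 (x y : cell0 P) (f g f' g' : gpath x y) (a : term2 f g) (b : term2 f' g') :=
  exists (ef : f = f') (eg : g = g'), eq21 (tcast ef eg a) b.

Local Notation "a =~ b" := (heq21 a b) (at level 70).

Lemma heq21_eq x y (f g : gpath x y) (a b : term2 f g) : a =~ b -> eq21 a b.
Proof.
by case=> ef [eg]; rewrite (Prop_irrelevance ef erefl) (Prop_irrelevance eg erefl).
Qed.

Lemma eq_heq21 x y (f g : gpath x y) (a b : term2 f g) : eq21 a b -> a =~ b.
Proof. by exists erefl, erefl. Qed.

Lemma heq21_refl x y (f g : gpath x y) (a : term2 f g) : a =~ a.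
Proof. exact/eq_heq21/eq21_refl. Qed.

Lemma heq21_sym x y (f g f' g' : gpath x y) (a : term2 f g) (b : term2 f' g') :
  a =~ b -> b =~ a.
Proof. by case=> ef [eg]; subst f' g' => /= ab; apply/eq_heq21/eq21_sym. Qed.

Lemma heq21_trans x y (f g f' g' f'' g'' : gpath x y)
    (a : term2 f g) (b : term2 f' g') (c : term2 f'' g'') :
  a =~ b -> b =~ c -> a =~ c.
Proof.
case=> ef [eg]; subst f' g' => /= ab; case=> ef [eg]; subst f'' g'' => /= bc.
exact/eq_heq21/(eq21_trans ab bc).
Qed.

Lemma heq21_cast x y (f g f' g' : gpath x y) (ef : f = f') (eg : g = g') (a : term2 f g) :
  tcast ef eg a =~ a.
Proof. by subst f' g'; apply: heq21_refl. Qed.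

Lemma heq21_comp1 x y (f g h f' g' h' : gpath x y) (a : term2 f g) (b : term2 g h)
    (a' : term2 f' g') (b' : term2 g' h') :
  a =~ a' -> b =~ b' -> tcomp1 a b =~ tcomp1 a' b'.
Proof.
case=> ef [eg]; subst f' g' => /= aa'; case=> eg [eh]; subst h'.
rewrite (Prop_irrelevance eg erefl) /= => bb'.
exact/eq_heq21/eq21_comp1.
Qed.

Lemma heq21_comp0 x y z (f g f' g' : gpath x y) (h k h' k' : gpath y z)
    (a : term2 f g) (b : term2 h k) (a' : term2 f' g') (b' : term2 h' k') :
  a =~ a' -> b =~ b' -> tcomp0 a b =~ tcomp0 a' b'.
Proof.
case=> ef [eg]; subst f' g' => /= aa'; case=> eh [ek]; subst h' k' => /= bb'.
exact/eq_heq21/eq21_comp0.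
Qed.

Lemma heq21_comp0A x y z t (f f' : gpath x y) (g g' : gpath y z) (h h' : gpath z t)
    (a : term2 f f') (b : term2 g g') (c : term2 h h') :
  tcomp0 a (tcomp0 b c) =~ tcomp0 (tcomp0 a b) c.
Proof. by exists (pcatA f g h), (pcatA f' g' h'); apply: eq21_comp0A. Qed.

Lemma heq21_id0l x y (f g : gpath x y) (a : term2 f g) : tcomp0 (tid (pnil x)) a =~ a.
Proof. exact/eq_heq21/eq21_id0l. Qed.

Lemma heq21_id0r x y (f g : gpath x y) (a : term2 f g) : tcomp0 a (tid (pnil y)) =~ a.
Proof. by exists (pcatp0 f), (pcatp0 g); apply: eq21_id0r. Qed.

Lemma heq21_id0 x y z (f : gpath x y) (g : gpath y z) :
  tcomp0 (tid f) (tid g) =~ tid (pcat f g).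
Proof. exact/eq_heq21/eq21_id0. Qed.

Lemma heq21_comp1A x y (f g h k : gpath x y) (a : term2 f g) (b : term2 g h) (c : term2 h k) :
  tcomp1 (tcomp1 a b) c =~ tcomp1 a (tcomp1 b c).
Proof. exact/eq_heq21/eq21_comp1A. Qed.

Lemma heq21_id1l x y (f g h : gpath x y) (a : term2 f g) (b : term2 h f) :
  b =~ tid f -> tcomp1 b a =~ a.
Proof.
move=> bE; apply: heq21_trans (heq21_comp1 bE (heq21_refl a)) _.
exact/eq_heq21/eq21_id1l.
Qed.

(** * Whiskering *)

Lemma whiskerl_comp1 x y z (p : gpath x y) (f g h : gpath y z) (a : term2 f g) (b : term2 g h) :
  tcomp0 (tid p) (tcomp1 a b) =~ tcomp1 (tcomp0 (tid p) a) (tcomp0 (tid p) b).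
Proof.
apply/eq_heq21; apply: eq21_trans (eq21_exchange _ _ _ _).
apply: eq21_comp0 (eq21_refl _); apply/eq21_sym/eq21_id1l.
Qed.

Lemma whiskerr_comp1 x y z (q : gpath y z) (f g h : gpath x y) (a : term2 f g) (b : term2 g h) :
  tcomp0 (tcomp1 a b) (tid q) =~ tcomp1 (tcomp0 a (tid q)) (tcomp0 b (tid q)).
Proof.
apply/eq_heq21; apply: eq21_trans (eq21_exchange _ _ _ _).
apply: eq21_comp0 (eq21_refl _) _; apply/eq21_sym/eq21_id1l.
Qed.

Lemma tcomp0_lr x y z (f g : gpath x y) (h k : gpath y z) (a : term2 f g) (b : term2 h k) :
  tcomp0 a b =~ tcomp1 (tcomp0 a (tid h)) (tcomp0 (tid g) b).
Proof.
apply/eq_heq21; apply: eq21_trans (eq21_exchange _ _ _ _).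
by apply: eq21_comp0; apply: eq21_sym; [apply: eq21_id1r | apply: eq21_id1l].
Qed.

Lemma tcomp0_rl x y z (f g : gpath x y) (h k : gpath y z) (a : term2 f g) (b : term2 h k) :
  tcomp0 a b =~ tcomp1 (tcomp0 (tid f) b) (tcomp0 a (tid k)).
Proof.
apply/eq_heq21; apply: eq21_trans (eq21_exchange _ _ _ _).
by apply: eq21_comp0; apply: eq21_sym; [apply: eq21_id1l | apply: eq21_id1r].
Qed.

Definition whisker (x y z t : cell0 P) (p : gpath x y) (f g : gpath y z) (a : term2 f g)
    (q : gpath z t) :=
  tcomp0 (tcomp0 (tid p) a) (tid q).

Lemma whisker_id x y z t (p : gpath x y) (f : gpath y z) (q : gpath z t) :
  whisker p (tid f) q =~ tid (pcat (pcat p f) q).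
Proof.
apply: heq21_trans (heq21_comp0 (heq21_id0 _ _) (heq21_refl _)) (heq21_id0 _ _).
Qed.

Lemma whisker_comp1 x y z t (p : gpath x y) (f g h : gpath y z) (q : gpath z t)
    (a : term2 f g) (b : term2 g h) :
  whisker p (tcomp1 a b) q =~ tcomp1 (whisker p a q) (whisker p b q).
Proof.
exact: heq21_trans (heq21_comp0 (whiskerl_comp1 _ _ _) (heq21_refl _)) (whiskerr_comp1 _ _ _).
Qed.

Lemma whisker_heq x y z t (p : gpath x y) (f g f' g' : gpath y z) (q : gpath z t)
    (a : term2 f g) (b : term2 f' g') : a =~ b -> whisker p a q =~ whisker p b q.
Proof.
move=> ab; apply: heq21_comp0 (heq21_comp0 (heq21_refl _) ab) (heq21_refl _).
Qed.

(** By exchange, the two factors act one after the other. The cells c and d are the whiskered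
    factors with boundaries rebracketed so that they compose. *)
Lemma whisker_comp0 x y z t u (p : gpath x y) (f f' : gpath y z) (g g' : gpath z t)
    (q : gpath t u) (a : term2 f f') (b : term2 g g') :
  exists (c : term2 (pcat (pcat p (pcat f g)) q) (pcat (pcat p (pcat f' g)) q))
    (d : term2 (pcat (pcat p (pcat f' g)) q) (pcat (pcat p (pcat f' g')) q)),
  [/\ c =~ whisker p a (pcat g q), d =~ whisker (pcat p f') b q &
    whisker p (tcomp0 a b) q =~ tcomp1 c d].
Proof.
exists (whisker p (tcomp0 a (tid g)) q), (whisker p (tcomp0 (tid f') b) q); split.
- apply: heq21_trans (heq21_comp0 (heq21_comp0A _ _ _) (heq21_refl _)) _.
  apply: heq21_trans (heq21_sym (heq21_comp0A _ _ _)) _.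
  exact: heq21_comp0 (heq21_refl _) (heq21_id0 _ _).
- apply: heq21_trans (heq21_comp0 (heq21_comp0A _ _ _) (heq21_refl _)) _.
  exact: heq21_comp0 (heq21_comp0 (heq21_id0 _ _) (heq21_refl _)) (heq21_refl _).
- apply: heq21_trans (whisker_heq _ _ (tcomp0_lr _ _)) _; exact: whisker_comp1.
Qed.

Lemma whisker_nil x y (f g : gpath x y) (a : term2 f g) : whisker (pnil x) a (pnil y) =~ a.
Proof. exact: heq21_trans (heq21_id0r _) (heq21_id0l _). Qed.

Lemma pres_eq_term2 (x y : cell0 P) (f g : gpath x y) : pres_eq f g -> inhabited (term2 f g).
Proof.
elim=> {x y f g} [a|x y f|x y f g _ [a]|x y f g h _ [a] _ [b]|x y z f f' g g' _ [a] _ [b]];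
  constructor.
- exact: tgen.
- exact: tid.
- exact: tinv.
- exact: tcomp1 a b.
- exact: tcomp0.
Qed.

Lemma term2_pres_eq (x y : cell0 P) (f g : gpath x y) : term2 f g -> pres_eq f g.
Proof.
elim=> {x y f g} [a|x y f|x y f g _ IH|x y f g h _ IH1 _ IH2|x y z f f' g g' _ IH1 _ IH2].
- exact: pres_eq_cell.
- exact: pres_eq_refl.
- exact: pres_eq_sym.
- exact: pres_eq_trans IH1 IH2.
- exact: pres_eq_cat.
Qed.

(** * Contraction along standard reductions *)

Section Contraction.
(** Here [nf] chooses normal forms and [std] singles out reductions to them, unique up to [eq21].
    The predicate [good] delimits the 1-cells that an induction has reached so far. *)
Variables (x0 y0 : cell0 P) (good : gpath x0 y0 -> Prop) (nf : gpath x0 y0 -> gpath x0 y0).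
Variable std : forall f, term2 f (nf f) -> Prop.
Hypotheses (good_eq : forall f g, pres_eq f g -> good f -> good g)
  (std_ex : forall f, good f -> exists a : term2 f (nf f), std a)
  (std_uniq : forall f (a b : term2 f (nf f)), std a -> std b -> eq21 a b)
  (std_gen : forall (e : cell2 P) (p : gpath x0 (src20 e)) (q : gpath (tgt20 e) y0) u v,
     @std (pcat (pcat p (src21 e)) q) u -> @std (pcat (pcat p (tgt21 e)) q) v ->
     u =~ tcomp1 (whisker p (tgen e) q) v).

Let std_ex_eq f g : pres_eq f g -> good f -> exists a : term2 g (nf g), std a.
Proof. by move=> fg /(good_eq fg)/std_ex. Qed.

Let std_cast f g (e : f = g) (u : term2 f (nf f)) : std u ->
  exists2 v : term2 g (nf g), std v & v =~ u.
Proof. by subst g => su; exists u => //; apply: heq21_refl. Qed.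

(** Structural induction on the term. Quantifying over the contexts p and q lets the case of
    [tcomp0] apply induction to each factor, whiskered by a boundary of the other. *)
Lemma std_term x y (f g : gpath x y) (a : term2 f g) (p : gpath x0 x) (q : gpath y y0) u v :
  good (pcat (pcat p f) q) ->
  @std (pcat (pcat p f) q) u -> @std (pcat (pcat p g) q) v ->
  u =~ tcomp1 (whisker p a q) v.
Proof.
elim: a p q u v => {x y f g} [e|x y f|x y f g a IH|x y f g h a IHa b IHb|
    x y z f f' g g' a IHa b IHb] p q u v good_f su sv.
- exact: std_gen.
- apply: heq21_trans (eq_heq21 (std_uniq su sv)) _.
  by apply/heq21_sym/heq21_id1l/whisker_id.
- have gf : pres_eq (pcat (pcat p g) q) (pcat (pcat p f) q).
    by apply/term2_pres_eq/whisker/tinv.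
  have gg : good (pcat (pcat p f) q) by apply: good_eq gf good_f.
  have e := IH p q v u gg sv su.
  apply: heq21_sym; apply: heq21_trans (heq21_comp1 (heq21_refl _) e) _.
  apply: heq21_trans (heq21_sym (heq21_comp1A _ _ _)) _.
  apply: heq21_id1l; apply: heq21_trans (heq21_sym (whisker_comp1 _ _ _ _)) _.
  apply: heq21_trans _ (whisker_id p g q); apply: whisker_heq.
  exact/eq_heq21/eq21_invl.
- have fg : pres_eq (pcat (pcat p f) q) (pcat (pcat p g) q).
    exact/term2_pres_eq/whisker.
  have [w sw] := std_ex_eq fg good_f.
  apply: heq21_trans (IHa p q u w good_f su sw) _.
  have := IHb p q w v (good_eq fg good_f) sw sv => e.
  apply: heq21_trans (heq21_comp1 (heq21_refl _) e) _.
  apply: heq21_trans (heq21_sym (heq21_comp1A _ _ _)) _.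
  exact: heq21_comp1 (heq21_sym (whisker_comp1 _ _ _ _)) (heq21_refl _).
- have [c [d [cE dE cd]]] := whisker_comp0 p q a b.
  have e1 : pcat (pcat p (pcat f g)) q = pcat (pcat p f) (pcat g q) by rewrite !pcatA.
  have e2 : pcat (pcat p f') (pcat g q) = pcat (pcat (pcat p f') g) q by rewrite !pcatA.
  have e3 : pcat (pcat p (pcat f' g')) q = pcat (pcat (pcat p f') g') q by rewrite !pcatA.
  have [u' su' uu'] := std_cast e1 su.
  have [v' sv' vv'] := std_cast e3 sv.
  have fg : pres_eq (pcat (pcat p f) (pcat g q)) (pcat (pcat p f') (pcat g q)).
    exact/term2_pres_eq/whisker.
  have good_f' : good (pcat (pcat p f) (pcat g q)) by rewrite -e1.
  have [w sw] := std_ex_eq fg good_f'.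
  have [w' sw' ww'] := std_cast e2 sw.
  have good_w' : good (pcat (pcat (pcat p f') g) q) by rewrite -e2; apply: good_eq fg _.
  apply: heq21_trans (heq21_sym uu') _.
  apply: heq21_trans (IHa _ _ _ _ good_f' su' sw) _.
  have e := heq21_trans (heq21_sym ww') (IHb _ _ _ _ good_w' sw' sv').
  apply: heq21_trans (heq21_comp1 (heq21_sym cE)
    (heq21_trans e (heq21_comp1 (heq21_sym dE) vv'))) _.
  apply: heq21_trans (heq21_sym (heq21_comp1A _ _ _)) _.
  exact: heq21_comp1 (heq21_sym cd) (heq21_refl _).
Qed.

(** In the empty context, a and b both turn the standard reduction of g into that of f;
    invertibility cancels the former. *)
Lemma std_coherent f g (a b : term2 f g) : good f -> eq21 a b.
Proof.
move=> good_f; have good_g := good_eq (term2_pres_eq a) good_f.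
have [u su] := std_ex good_f; have [v sv] := std_ex good_g.
have std_nil h (t : term2 h (nf h)) : std t ->
    exists2 t' : term2 (pcat (pcat (pnil x0) h) (pnil y0)) (nf (pcat (pcat (pnil x0) h) (pnil y0))),
      std t' & t' =~ t.
  by apply: std_cast; rewrite pcatp0.
have [u' su' uu'] := std_nil _ _ su; have [v' sv' vv'] := std_nil _ _ sv.
have good_f' : good (pcat (pcat (pnil x0) f) (pnil y0)) by rewrite pcatp0.
have E (c : term2 f g) : u =~ tcomp1 c v.
  apply: heq21_trans (heq21_sym uu') _.
  apply: heq21_trans (std_term c good_f' su' sv') _.
  exact: heq21_comp1 (whisker_nil _) vv'.
have /heq21_eq ab := heq21_trans (heq21_sym (E a)) (E b).
have K (c : term2 f g) : eq21 (tcomp1 (tcomp1 c v) (tinv v)) c.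
  apply: eq21_trans (eq21_comp1A _ _ _) _; apply: eq21_trans _ (eq21_id1r _).
  exact: eq21_comp1 (eq21_refl _) (eq21_invr _).
apply: eq21_trans (eq21_sym (K a)) _; apply: eq21_trans _ (K b).
exact: eq21_comp1 ab (eq21_refl _).
Qed.

End Contraction.
End HeterogeneousEquality.

(** * Garside's homotopy basis *)

Section GarsideCoherence.
Variable W : coxeter_group.
Local Open Scope group_scope.

Local Notation cell w w' := (@term2 (Gar3 W) tt tt (word_path w) (word_path w')).
Local Notation "a =~ b" := (@heq21 (Gar3 W) tt tt _ _ _ _ a b) (at level 70).
Local Notation gid w := (@tid (Gar3 W) tt tt (word_path w)).
Local Notation gen2 e := (@tgen (Gar3 W) e).
Local Notation "a ** b" := (@tcomp0 (Gar3 W) tt tt tt _ _ _ _ a b)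
  (at level 40, left associativity).
Local Notation "a ;; b" := (@tcomp1 (Gar3 W) tt tt _ _ _ a b) (at level 50, left associativity).

(** Preserved by all 2-cells and strictly smaller for the tail of a word: the measure of the
    induction that proves coherence. *)
Definition gar_weight (w : seq (gar1 W)) : nat :=
  sumn [seq cox_length (sval u) | u <- w].

Lemma gar_weight_cat w w' : gar_weight (w ++ w') = (gar_weight w + gar_weight w')%N.
Proof. by rewrite /gar_weight map_cat sumn_cat. Qed.

Lemma pres_eq_weight (x y : cell0 (Gar2 W)) (f g : gpath x y) : pres_eq f g ->
  gar_weight (path_word f) = gar_weight (path_word g).
Proof.
elim=> {x y f g} //=.
- by move=> a; rewrite /gar_weight /= !addn0 (g2_len a).
- by move=> x y f g h _ -> _ ->.
- by move=> x y z f f' g g' _ IH1 _ IH2; rewrite !path_word_cat !gar_weight_cat IH1 IH2.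
Qed.

Lemma gar_eq_cell w w' : @pres_eq (Gar2 W) tt tt (word_path w) (word_path w') ->
  inhabited (cell w w').
Proof. exact: (@pres_eq_term2 (Gar3 W)). Qed.

Definition path_nf (f : @gpath (bouquet (gar1 W)) tt tt) : @gpath (bouquet (gar1 W)) tt tt :=
  word_path (gar_nf (path_word f)).

Lemma word_path_inj (w w' : seq (gar1 W)) : word_path w = word_path w' -> w = w'.
Proof. by move=> e; rewrite -(word_pathK w) e word_pathK. Qed.

(* A standard reduction to the normal form reduces the tail first, to a word whose
   first letter completes the head, and then merges these two letters. *)
Definition standard (f : @gpath (bouquet (gar1 W)) tt tt)
    (a : @term2 (Gar3 W) tt tt f (path_nf f)) : Prop :=
  [/\ f = word_path [::] -> gid [::] =~ a,
      forall x w r (c : cell w r), f = word_path (x :: w) ->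
        gar_nf (x :: w) = x :: r -> gid [:: x] ** c =~ a &
      forall e w r (c : cell w (g2v e :: r)), f = word_path (g2u e :: w) ->
        gar_nf (g2u e :: w) = gar_mul e :: r ->
        (gid [:: g2u e] ** c) ;; (gen2 e ** gid r) =~ a].

Lemma gar_cell2_inj (e e' : gar_cell2 W) : g2u e = g2u e' ->
  sval (gar_mul e) = sval (gar_mul e') -> e = e'.
Proof.
case: e e' => u v l [u' v' l'] /= uu'; subst u' => /= /mulgI vv'.
have {}vv' : v = v' by apply: val_inj.
by subst v'; congr GarCell2; apply: Prop_irrelevance.
Qed.

(** The element completing the head is trivial or a letter. The two cases match the last two clauses
    of [standard] and exclude each other by [headN]. *)
Variant head_spec (x : gar1 W) (w : seq (gar1 W)) : Prop :=
| HeadId r of gar_nf (x :: w) = x :: r & inhabited (cell w r)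
| HeadMul e r of x = g2u e & gar_nf (g2u e :: w) = gar_mul e :: r &
    inhabited (cell w (g2v e :: r)).

Lemma headP x w : head_spec x w.
Proof.
have [m [r [y [nfE mE xy wyr]]]] := gar_nf_head x w.
have [y1|/letterN1[z zE zy]] := eqVneq y 1.
  rewrite y1 letter1 mulg1 in wyr mE; have mx : m = x by apply: val_inj.
  by rewrite mx in nfE; apply: HeadId nfE _; apply: gar_eq_cell.
rewrite zE in wyr; have /eqP xy' := xy; rewrite -zy in xy' mE.
apply: (@HeadMul _ _ (GarCell2 xy') r) => //; last exact: gar_eq_cell.
by rewrite nfE; congr cons; apply: val_inj; apply: mE.
Qed.

Lemma headN (e : gar_cell2 W) w r r' : gar_nf (g2u e :: w) = gar_mul e :: r ->
  gar_nf (g2u e :: w) = g2u e :: r' -> False.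
Proof.
move=> -> [/(congr1 sval) /= /eqP]; rewrite -{2}[sval (g2u e)]mulg1 => /eqP/mulgI v1 _.
by have := svalP (g2v e); rewrite /= v1 eqxx.
Qed.

Lemma standard_uniq f (a b : @term2 (Gar3 W) tt tt f (path_nf f)) :
  standard a -> standard b -> eq21 a b.
Proof.
rewrite -(path_wordK f) in a b *.
case: (path_word f) a b => [|x w] a b [a0 a1 a2] [b0 b1 b2]; apply: heq21_eq.
  exact: heq21_trans (heq21_sym (a0 erefl)) (b0 erefl).
case: (headP x w) => [r nfE [c]|e r xE nfE [c]].
  exact: heq21_trans (heq21_sym (a1 _ _ _ c erefl nfE)) (b1 _ _ _ c erefl nfE).
subst x; exact: heq21_trans (heq21_sym (a2 _ _ _ c erefl nfE)) (b2 _ _ _ c erefl nfE).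
Qed.

(** The clauses of [standard] quantify over every reduction c of the tail; coherence for words of
    smaller weight shows that all choices of c agree. *)
Lemma standard_ex N :
  (forall w w' (a b : cell w w'), gar_weight w < N -> eq21 a b) ->
  forall f : @gpath (bouquet (gar1 W)) tt tt, gar_weight (path_word f) < N.+1 ->
  exists a : @term2 (Gar3 W) tt tt f (path_nf f), standard a.
Proof.
move=> coh f; rewrite -(path_wordK f); case: (path_word f) => [_|x w].
  by exists (gid [::]); split=> // _; apply: heq21_refl.
rewrite word_pathK => wN; have wN' : gar_weight w < N.
  rewrite ltnS in wN; apply: leq_trans wN; rewrite /gar_weight /= -[X in X < _]add0n ltn_add2r.
  by rewrite lt0n length_eq0 (svalP x).
case: (headP x w) => [r nfE [c]|e r xE nfE [c]].
  have nfE' : word_path (x :: r) = path_nf (word_path (x :: w)).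
    by rewrite /path_nf word_pathK nfE.
  exists (@tcast (Gar3 W) tt tt _ _ _ _ erefl nfE' (gid [:: x] ** c)).
  split=> [/word_path_inj //| |].
    move=> x' w' r' c' /word_path_inj[xx' ww']; subst x' w'; rewrite nfE => -[rr'].
    subst r'; apply: heq21_trans _ (heq21_sym (heq21_cast _ _ _)).
    apply: heq21_comp0 (heq21_refl _) (eq_heq21 _); exact: coh.
  move=> e w' r' c' /word_path_inj[xe ww'] nfe; subst x w'.
  by case: (headN nfe nfE).
subst x; have nfE' : word_path (gar_mul e :: r) = path_nf (word_path (g2u e :: w)).
  by rewrite /path_nf word_pathK nfE.
exists (@tcast (Gar3 W) tt tt _ _ _ _ erefl nfE' ((gid [:: g2u e] ** c) ;; (gen2 e ** gid r))).
split=> [/word_path_inj //| |].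
  move=> x w' r' c' /word_path_inj[xe ww'] nfe; subst x w'.
  by case: (headN nfE nfe).
move=> e' w' r' c' /word_path_inj[ee' ww']; subst w' => nfe'.
have [mm' rr'] : gar_mul e :: r = gar_mul e' :: r' by rewrite -nfE ee' nfe'.
have {}ee' := gar_cell2_inj ee' mm'; subst e' r'.
apply: heq21_trans _ (heq21_sym (heq21_cast _ _ _)).
apply: heq21_comp1 (heq21_comp0 (heq21_refl _) (eq_heq21 _)) (heq21_refl _); exact: coh.
Qed.

(** * Absorption of generating 2-cells *)

Lemma cell_cast w1 w1' w2 w2' f g (ef : f = word_path (w1 ++ w1')) (eg : g = word_path (w2 ++ w2'))
  (a : @term2 (Gar3 W) tt tt f g) : exists b : cell (w1 ++ w1') (w2 ++ w2'), b =~ a.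
Proof. by subst f g; exists a; apply: heq21_refl. Qed.

Lemma gar_nf_merge (e : gar_cell2 W) p q :
  gar_nf (p ++ [:: g2u e; g2v e] ++ q) = gar_nf (p ++ gar_mul e :: q).
Proof.
by rewrite !gar_nf_cat /= gar_lmulM //; apply/eqP/(g2_len e).
Qed.

Lemma whisker_cons x p q f g (a : @term2 (Gar3 W) tt tt f g) :
  gid [:: x] ** @whisker (Gar3 W) tt tt tt tt (word_path p) _ _ a (word_path q) =~
  @whisker (Gar3 W) tt tt tt tt (word_path (x :: p)) _ _ a (word_path q).
Proof.
apply: heq21_trans (heq21_comp0A _ _ _) _.
apply: heq21_comp0 (heq21_refl _); apply: heq21_trans (heq21_comp0A _ _ _) _.
exact: heq21_comp0 (@heq21_id0 (Gar3 W) tt tt tt (word_path [:: x]) _) (heq21_refl _).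
Qed.

Lemma merge_exchange (e : gar_cell2 W) q z (c : cell q z) :
  (gid [:: g2u e] ** (gid [:: g2v e] ** c)) ;; (gen2 e ** gid z) =~
  (gen2 e ** gid q) ;; (gid [:: gar_mul e] ** c).
Proof.
apply: heq21_trans (tcomp0_lr (gen2 e) c).
apply: heq21_trans (heq21_sym (tcomp0_rl (gen2 e) c)).
apply: heq21_comp1 (heq21_refl _); apply: heq21_trans (heq21_comp0A _ _ _) _.
exact: heq21_comp0 (@heq21_id0 (Gar3 W) tt tt tt (word_path [:: g2u e]) _) (heq21_refl _).
Qed.

(** If uv is already the first letter of the normal form, exchange suffices. Otherwise uv is
    completed by a letter w, while u is completed by vw; up to exchange, the two reductions are the
    two sides of $A_{u,v,w}$. *)
Lemma standard_gen_head (e : gar_cell2 W) q u v :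
  @standard (word_path (g2u e :: g2v e :: q)) u ->
  @standard (word_path (gar_mul e :: q)) v ->
  u =~ @tcomp1 (Gar3 W) tt tt _ _ _
    (@whisker (Gar3 W) tt tt tt tt (word_path [::]) _ _ (gen2 e) (word_path q)) v.
Proof.
(* Rebuilding [e] from its fields makes it convertible with [face_u_v A] for the 3-cell [A] chosen
   below. *)
case: e u v => x y l; pose e := GarCell2 l; rewrite -/e => u v [_ u1 u2] [_ v1 v2].
have genE : gen2 e ** gid q =~
    @whisker (Gar3 W) tt tt tt tt (word_path [::]) _ _ (gen2 e) (word_path q).
  exact: heq21_comp0 (heq21_sym (heq21_id0l _)) (heq21_refl _).
have nfm : gar_nf (g2u e :: g2v e :: q) = gar_nf (gar_mul e :: q) := gar_nf_merge e [::] q.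
case: (headP (gar_mul e) q) => [r nfE [c]|e' r xE nfE [c]].
  have uE := u2 e (g2v e :: q) r (gid [:: g2v e] ** c) erefl (etrans nfm nfE).
  have vE := v1 (gar_mul e) q r c erefl nfE.
  apply: heq21_trans (heq21_sym uE) _; apply: heq21_trans (merge_exchange _ _) _.
  exact: heq21_comp1 genE vE.
have add1 : additive (sval (g2u e)) (sval (g2v e)) by apply/eqP/(g2_len e).
have add2 : additive (sval (gar_mul e)) (sval (g2v e')) by rewrite xE; apply/eqP/(g2_len e').
have [/eqP add3 _] := additiveP add1 add2.
have add4 : cox_length (sval (g2u e) * sval (g2v e) * sval (g2v e'))%g =
    (cox_length (sval (g2u e)) + cox_length (sval (g2v e)) + cox_length (sval (g2v e')))%N.
  by rewrite -(eqP add1); apply/eqP.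
pose A := @GarCell3 W (g2u e) (g2v e) (g2v e') (g2_len e) add3 add4.
have e'A : e' = face_uv_w A by apply: gar_cell2_inj; rewrite /= -xE.
have nfE' : gar_nf (g2u e :: g2v e :: q) = gar_mul (face_u_vw A) :: r.
  by rewrite nfm gar_mulA -e'A xE.
have nfE'' : gar_nf (g2u (face_uv_w A) :: q) = gar_mul (face_uv_w A) :: r by rewrite -e'A.
(* Since [standard] accepts any reduction of the tail, the one taken here reduces q first and then
   merges v with w. *)
have uE := u2 (face_u_vw A) (g2v e :: q) r
  ((gid [:: g2v e] ** c) ;; (gen2 (face_v_w A) ** gid r)) erefl nfE'.
have vE := v2 (face_uv_w A) q r c erefl nfE''.
apply: heq21_trans (heq21_sym uE) _; apply: heq21_trans _ (heq21_comp1 genE vE).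
apply: heq21_trans _ (heq21_comp1A _ _ _).
apply: heq21_trans _ (heq21_comp1 (merge_exchange e c) (heq21_refl _)).
apply: heq21_trans (heq21_comp1 (whiskerl_comp1 _ _ _) (heq21_refl _)) _.
apply: heq21_trans (heq21_comp1A _ _ _) _; apply: heq21_trans _ (heq21_sym (heq21_comp1A _ _ _)).
apply: heq21_comp1 (heq21_refl _) _.
have rhsE : (gen2 e ** gid (g2v e' :: r)) ;; (gen2 (face_uv_w A) ** gid r) =~
    ((gen2 e ** gid [:: g2v e']) ;; gen2 (face_uv_w A)) ** gid r.
  apply: heq21_trans _ (heq21_sym (whiskerr_comp1 _ _ _)).
  apply: heq21_comp1 _ (heq21_refl _).
  refine (heq21_trans _ (@heq21_comp0A (Gar3 W) tt tt tt tt _ _ _ _ _ _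
    (gen2 e) (gid [:: g2v e']) (gid r))).
  apply: heq21_comp0 (heq21_refl _) (heq21_sym _).
  exact: (@heq21_id0 (Gar3 W) tt tt tt (word_path [:: g2v e'])).
apply: heq21_trans _ (heq21_sym rhsE).
refine (heq21_trans (heq21_comp1 (@heq21_comp0A (Gar3 W) tt tt tt tt _ _ _ _ _ _
  (gid [:: g2u e]) (gen2 (face_v_w A)) (gid r)) (heq21_refl _)) _).
refine (heq21_trans (heq21_sym (@whiskerr_comp1 (Gar3 W) tt tt tt _ _ _ _
  (gid [:: g2u e] ** gen2 (face_v_w A)) (gen2 (face_u_vw A)))) _).
apply: heq21_comp0 _ (heq21_refl _); apply: heq21_sym.
exact: heq21_trans (eq_heq21 (@eq21_cell (Gar3 W) A)) (heq21_cast _ _ _).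
Qed.

(** With a nonempty left context the 2-cell lies in the tail: followed by a reduction of the new
    tail, it is a reduction of the old one, with the same head and normal form. *)
Lemma standard_gen (e : gar_cell2 W) (p q : @gpath (bouquet (gar1 W)) tt tt) u v :
  @standard (pcat (pcat p (src21 (e : cell2 (Gar2 W)))) q) u ->
  @standard (pcat (pcat p (tgt21 (e : cell2 (Gar2 W)))) q) v ->
  u =~ @tcomp1 (Gar3 W) tt tt _ _ _ (@whisker (Gar3 W) tt tt tt tt p _ _ (gen2 e) q) v.
Proof.
move: u v; rewrite -(path_wordK p) -(path_wordK q).
case: (path_word p) (path_word q) => [|x p'] {p q} q u v su sv.
  exact: standard_gen_head.
case: su sv => _ u1 u2 [_ v1 v2].
pose w1 := p' ++ [:: g2u e; g2v e] ++ q; pose w2 := p' ++ [:: gar_mul e] ++ q.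
have nf12 : gar_nf (x :: w1) = gar_nf (x :: w2) := gar_nf_merge e (x :: p') q.
have pathE (w : seq (gar1 W)) :
    pcat (pcat (word_path p') (word_path w)) (word_path q) = word_path (p' ++ w ++ q).
  by rewrite !word_path_cat pcatA.
have [b bE] := cell_cast (pathE [:: g2u e; g2v e]) (pathE [:: gar_mul e])
  (@whisker (Gar3 W) tt tt tt tt (word_path p') _ _ (gen2 e) (word_path q)).
have {}bE : gid [:: x] ** b =~
    @whisker (Gar3 W) tt tt tt tt (word_path (x :: p')) _ _ (gen2 e) (word_path q).
  exact: heq21_trans (heq21_comp0 (heq21_refl _) bE) (whisker_cons _ _ _ _).
have pathE' (w : seq (gar1 W)) :
    pcat (pcat (word_path (x :: p')) (word_path w)) (word_path q) =
    word_path (x :: p' ++ w ++ q) by rewrite /= -pathE.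
case: (headP x w2) => [r nfE [c]|e' r xE nfE [c]].
  have uE := u1 x w1 r (b ;; c) (pathE' _) (etrans nf12 nfE).
  have vE := v1 x w2 r c (pathE' _) nfE.
  apply: heq21_trans (heq21_sym uE) _; apply: heq21_trans (whiskerl_comp1 _ _ _) _.
  exact: heq21_comp1 bE vE.
subst x; have uE := u2 e' w1 r (b ;; c) (pathE' _) (etrans nf12 nfE).
have vE := v2 e' w2 r c (pathE' _) nfE.
apply: heq21_trans (heq21_sym uE) _.
apply: heq21_trans (heq21_comp1 (whiskerl_comp1 _ _ _) (heq21_refl _)) _.
apply: heq21_trans (heq21_comp1A _ _ _) _.
exact: heq21_comp1 bE vE.
Qed.

(** Induction on a strict bound N for the weight: coherence below N makes standard reductions
    unambiguous one step higher, where the contraction then applies. *)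
Lemma Gar3_homotopy_basis : homotopy_basis (Gar3 W).
Proof.
have coh N w w' (a b : cell w w') : gar_weight w < N -> eq21 a b.
  elim: N w w' a b => // N IHN w w' a b wN.
  apply: (@std_coherent (Gar3 W) tt tt (fun f => gar_weight (path_word f) < N.+1) path_nf standard).
  - by move=> f g /pres_eq_weight <-.
  - exact: standard_ex.
  - exact: standard_uniq.
  - exact: standard_gen.
  - by rewrite word_pathK.
move=> [] [] f g; rewrite -(path_wordK f) -(path_wordK g) => a b.
exact: coh (ltnSn _).
Qed.

End GarsideCoherence.

Theorem theorem3p1p3 (W : coxeter_group) :
  coherent_presentation (Gar3 W) (artin_monoid W).
Proof. by split; [apply: Gar2_presents_artin | apply: Gar3_homotopy_basis]. Qed.
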